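(* Let $\Delta,k$ be positive integers and $\varepsilon$ a real number with $\Delta^{-7}/1000\ge\varepsilon\ge k^{-1}$. Let $T$ be a $k$-edge tree with maximum degree $\Delta(T)\le\Delta$. Let $G$ be a connected graph with $\delta(G)\ge k/2$. Suppose that $G$ contains a bipartite subgraph $B$ with parts $X,Y$ such that $|X|\le(1+\varepsilon)k/2$, $|Y|\ge 6k$, every vertex of $X$ has degree at least $(1-\varepsilon)|Y|$ in $B$, and every vertex of $Y$ has degree at least $(1-\varepsilon)k/2$ in $B$. Then $G$ contains a copy of $T$.
   Context: Graphs are finite and simple; $\delta(G)$ denotes the minimum degree. A copy of $T$ in $G$ is a (not necessarily induced) subgraph of $G$ isomorphic to $T$. *)

(* Defs.v *)
From mathcomp Require Import all_boot.

Set Implicit Arguments.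
Unset Strict Implicit.
Unset Printing Implicit Defensive.

Record sgraph := SGraph {
  vertex :> finType;
  edge : rel vertex;
  edge_sym : symmetric edge;
  edge_irr : irreflexive edge }.

Section Graphs.
Variable G : sgraph.

Definition degree (x : G) : nat := #|[set y | edge x y]|.

(* Every degree is less than #|G|, so the default value of the minimum only
   matters for the graph with no vertices. *)
Definition min_degree : nat := \big[minn/#|G|]_(x : G) degree x.

Definition max_degree : nat := \max_(x : G) degree x.

Definition edge_set : {set {set G}} :=
  [set [set e.1; e.2] | e : G * G & edge e.1 e.2].

Definition connected : Prop :=
  0 < #|G| /\ forall x y : G, connect (@edge G) x y.

(* A closed walk x, y, x is a ucycle of length 2, hence the size condition. *)
Definition acyclic : Prop :=
  forall c : seq G, 2 < size c -> ~ ucycle (@edge G) c.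

Definition is_tree : Prop := connected /\ acyclic.

Definition bipartition (X Y : {set G}) : Prop :=
  [/\ X :|: Y = [set: G], [disjoint X & Y] &
      forall x y : G, edge x y ->
        (x \in X /\ y \in Y) \/ (x \in Y /\ y \in X)].

(* Not necessarily induced. *)
Record subgraph := Subgraph {
  sub_vertex : {set G};
  sub_edge : rel G;
  sub_edge_sym : symmetric sub_edge;
  sub_edgeG : subrel sub_edge (@edge G);
  sub_edge_vertex : forall x y, sub_edge x y -> x \in sub_vertex }.

Section SubgraphGraph.
Variable H : subgraph.

Definition subgraph_edge : rel {x | x \in sub_vertex H} :=
  fun x y => sub_edge H (val x) (val y).

Lemma subgraph_edge_sym : symmetric subgraph_edge.
Proof. by move=> x y; apply: sub_edge_sym. Qed.

Lemma subgraph_edge_irr : irreflexive subgraph_edge.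
Proof.
move=> x; apply/negP => /(@sub_edgeG H).
by rewrite edge_irr.
Qed.

Definition graph_of_subgraph : sgraph :=
  SGraph subgraph_edge_sym subgraph_edge_irr.

End SubgraphGraph.

End Graphs.

Coercion graph_of_subgraph : subgraph >-> sgraph.

Definition isomorphic (G H : sgraph) : Prop :=
  exists f : G -> H, bijective f /\ forall x y, edge (f x) (f y) = edge x y.

Definition contains_copy (G T : sgraph) : Prop :=
  exists H : subgraph G, isomorphic T H.

(* Main.v *)
Require Import Defs.
From mathcomp Require Import all_boot all_order all_algebra.
From mathcomp Require Import reals zify lra.

(** Let A be the smaller colour class of T.  If |A| <= |X|, map A into X in any
    injective way and the rest of T greedily into Y, because few vertices of X
    always have many common neighbours in Y.  Otherwise put m = |A| - |X|, which
    is at most e = floor (eps k); now m vertices of A have to be placed outside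
    X.  Since the minimum degree is at least k/2, each vertex outside X has at
    least m neighbours outside X.  Call a vertex outside X rich if it is adjacent
    to almost all of X, a hub if it has many rich neighbours, and wild if it is
    neither.  There are three sources of savings.
    - A hub can host any a in A, the neighbours of a going to rich vertices.
    - If there are fewer than m hubs, wild vertices have large degree among
      themselves; so if a rich vertex has a wild neighbour, a pendant subtree of
      T with at least m vertices in A can be embedded among wild vertices only.
    - Otherwise, with h < m hubs, each rich vertex has m - h neighbours among the
      rich vertices that are not hubs, while each rich non-hub has few of them.
      This gives many disjoint edges between rich vertices.  Such an edge saves
      one vertex by hosting a leaf a in A with its neighbour.  If A has few
      leaves, then, T being almost balanced, almost all of A has degree 2, and
      one can move some c outside A into X, and the neighbours of c, all of
      degree 2, to rich vertices matched with hosts for their other neighbours.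
    The savings are local and pairwise disjoint in T, and the remaining
    vertices of T are embedded greedily. *)

Set Implicit Arguments.
Unset Strict Implicit.
Unset Printing Implicit Defensive.

(** * Neighbourhoods and common neighbours *)

Section Neighbours.
Variable G : sgraph.
Implicit Types (x y : G) (S W : {set G}).

Definition nbr x : {set G} := [set y | edge x y].

Lemma in_nbr x y : (y \in nbr x) = edge x y.
Proof. by rewrite inE. Qed.

Lemma degreeE x : degree x = #|nbr x|.
Proof. by []. Qed.

Lemma edge_symP x y : edge x y -> edge y x.
Proof. by rewrite edge_sym. Qed.

Lemma card_bigcup_le (I : finType) (J : {set I}) (F : I -> {set G}) d :
  (forall i, i \in J -> #|F i| <= d) -> #|\bigcup_(i in J) F i| <= #|J| * d.
Proof.
move=> Fd; rewrite -sum_nat_const.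
elim/big_rec2: _ => [|i n U Ji Un]; first by rewrite cards0.
by rewrite (leq_trans (leq_card_setU _ _)) // leq_add ?Fd.
Qed.

(** Each [w] excludes at most [d] vertices of [Y], so [U] and the excluded vertices together cannot
    fill [Y]. *)
Lemma exists_common_neighbour (Y U W : {set G}) d :
    (forall w, w \in W -> #|Y :\: nbr w| <= d) -> #|U| + #|W| * d < #|Y| ->
  exists y, [/\ y \in Y, y \notin U & forall w, w \in W -> edge w y].
Proof.
move=> Wd ltY.
have: ~~ (Y \subset U :|: \bigcup_(w in W) (Y :\: nbr w)).
  apply/negP => /subset_leq_card; rewrite leqNgt => /negP; apply.
  apply: leq_ltn_trans (leq_card_setU _ _) _.
  by apply: leq_ltn_trans ltY; rewrite leq_add2l; apply: card_bigcup_le.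
case/subsetPn => y Yy; rewrite in_setU negb_or => /andP [Uy /bigcupP Wy].
exists y; split=> // w Ww; apply: contraT => wy.
by case: Wy; exists w; rewrite // !inE wy.
Qed.

End Neighbours.

Lemma exists_notin (I : finType) (A B : {set I}) :
  #|B| < #|A| -> exists2 x, x \in A & x \notin B.
Proof.
move=> ltBA; apply/subsetPn; apply/negP => /subset_leq_card.
by rewrite leqNgt ltBA.
Qed.

(** * Rooted trees *)

Section RootedTree.
Variable T : sgraph.
Implicit Types (x y : T) (S : {set T}).

(** [p] is the parent map, total and fixing the root so that it can be iterated, and [h] is a
    height. The last clause carries the acyclicity: every edge inside [S] joins a vertex to its
    parent. *)
Definition rooted_on S (r : T) (p : T -> T) (h : T -> nat) :=
  [/\ r \in S, p r = r,
      forall x, x \in S -> x != r ->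
        [/\ p x \in S, edge x (p x) & h x = (h (p x)).+1] &
      forall x y, x \in S -> y \in S -> edge x y ->
        x != r /\ y = p x \/ y != r /\ x = p y].

Definition edge_in S x y := [&& edge x y, x \in S & y \in S].

Lemma connect_edge_in_root S r p h x :
  rooted_on S r p h -> x \in S -> connect (edge_in S) x r.
Proof.
case=> rS pr pS _; have [n] := ubnP (h x); elim: n x => // n IHn x ltn xS.
have [->|xr] := eqVneq x r; first exact: connect0.
have [pxS xpx hx] := pS x xS xr.
apply: (@connect_trans _ _ (p x)); first by apply: connect1; apply/and3P.
by apply: IHn => //; rewrite hx in ltn.
Qed.

Lemma edge_in_sym S : symmetric (edge_in S).
Proof. by move=> x y; rewrite /edge_in edge_sym [(y \in S) && _]andbC. Qed.

(* Two neighbours in the connected set S would close a cycle through v. *)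
Lemma unique_neighbour S r p h v x y :
    acyclic T -> rooted_on S r p h -> v \notin S ->
  x \in S -> y \in S -> edge v x -> edge v y -> x = y.
Proof.
move=> acT Srp vS xS yS vx vy; apply/eqP; apply: contraT => xy; exfalso.
have conn: connect (edge_in S) x y.
  apply: connect_trans (connect_edge_in_root Srp xS) _.
  rewrite (sym_connect_sym (@edge_in_sym S)).
  exact: connect_edge_in_root Srp yS.
case/connectP: conn => q0 q0P ylast; move: xy vy yS; rewrite ylast => {ylast}.
case/shortenP: q0P => q qP uq _ xq vq qS.
apply: (acT (v :: x :: q)).
  by case: q xq {qP uq vq qS} => //; rewrite eqxx.
rewrite /ucycle /=; apply/andP; split.
  rewrite vx rcons_path [edge _ v]edge_sym vq andbT.
  by apply: sub_path qP => a b /andP [].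
move: uq => /= ->; rewrite andbT inE negb_or.
have vx': v != x by apply: contraNneq vS => ->.
rewrite vx' /=; apply: contra vS.
elim: q x qP {xS vx xq vq qS vx'} => //= a q IHq x /andP [/and3P [_ _ aS]] /IHq{}IHq.
by rewrite inE => /orP [/eqP ->|].
Qed.

(** By [unique_neighbour], [x] is the only neighbour of [v] in [S], so making [x] the parent of [v]
    accounts for every new edge. *)
Lemma rooted_on_grow S r p h x v :
    acyclic T -> rooted_on S r p h -> x \in S -> v \notin S -> edge x v ->
  exists p' h', rooted_on (v |: S) r p' h'.
Proof.
move=> acT Srp xS vS xv; have [rS pr pS eS] := Srp.
exists (fun u => if u == v then x else p u).
exists (fun u => if u == v then (h x).+1 else h u).
have neS u: u \in S -> (u == v) = false.
  by move=> uS; apply: contraNF vS => /eqP <-.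
split=> [||u|u w].
- by rewrite setU1r.
- by rewrite neS.
- rewrite in_setU1; have [-> _ _|_ /= uS ur] := eqVneq u v.
    by rewrite neS // edge_sym setU1r.
  by have [puS upu hu] := pS u uS ur; rewrite neS // setU1r.
have vr: v != r by apply: contraNneq vS => ->.
rewrite !in_setU1; have [->|uv] := eqVneq u v; have [->|wv] := eqVneq w v => //=.
- by rewrite edge_irr.
- move=> _ wS vw; left; split => //.
  exact: (unique_neighbour acT Srp vS wS xS vw (edge_symP xv)).
- move=> uS _ uv'; right; split => //.
  exact: (unique_neighbour acT Srp vS uS xS (edge_symP uv') (edge_symP xv)).
- by move=> uS wS /eS; apply.
Qed.

Lemma rooted_tree r : is_tree T -> exists p h, rooted_on [set: T] r p h.
Proof.
case=> [[_ conT] acT].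
suff grow S p h : rooted_on S r p h -> exists p' h', rooted_on [set: T] r p' h'.
  apply: (grow [set r] id (fun=> 0)); split; rewrite ?in_set1 //.
    by move=> x /set1P ->; rewrite eqxx.
  by move=> x y /set1P -> /set1P ->; rewrite edge_irr.
have [n] := ubnP #|~: S|; elim: n S p h => // n IHn S p h ltn Srp.
have [S_T|/set0Pn [v]] := eqVneq (~: S) set0.
  by exists p, h; rewrite -setC0 -S_T setCK.
rewrite in_setC => vS; have [rS _ _ _] := Srp.
(* A path from [r] to [v] leaves [S] somewhere; the edge on which it does so is used to grow [S]. *)
have [x [y [xS yS xy]]] : exists x y, [/\ x \in S, y \notin S & edge x y].
  suff walk q a : a \in S -> path (@edge T) a q -> last a q \notin S ->
      exists x y, [/\ x \in S, y \notin S & edge x y].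
    by case/connectP: (conT r v) vS => q qP ->; exact: walk qP.
  elim: q a => /= [a ->//|b q IHq a aS /andP [ab bq]].
  by case bS: (b \in S); [exact: IHq bS bq|exists a, b; rewrite bS].
have [p' [h' S'rp]] := rooted_on_grow acT Srp xS yS xy.
apply: IHn S'rp; rewrite -ltnS; apply: leq_trans ltn.
rewrite ltnS proper_card // /proper !setCS subsetUr /=.
by apply: contra yS => /subsetP; apply; rewrite setU11.
Qed.

End RootedTree.

Definition two_coloring (G : sgraph) (A : {set G}) :=
  forall x y : G, edge x y -> (x \in A) = (y \notin A).

Section RootedTreeTheory.
Variables (T : sgraph) (r : T) (p : T -> T) (h : T -> nat).
Hypothesis T_root : rooted_on [set: T] r p h.
Implicit Types (x y v : T) (A : {set T}).

Lemma parent_root : p r = r.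
Proof. by have [] := T_root. Qed.

Lemma parent_edge x : x != r -> edge x (p x).
Proof. by have [_ _ pS _] := T_root => /(pS x (in_setT _)) []. Qed.

Lemma parent_height x : x != r -> h x = (h (p x)).+1.
Proof. by have [_ _ pS _] := T_root => /(pS x (in_setT _)) []. Qed.

Lemma parent_height_le x : h (p x) <= h x.
Proof.
by have [->|/parent_height ->] := eqVneq x r; rewrite ?parent_root.
Qed.

Lemma edge_parent x y : edge x y -> x != r /\ y = p x \/ y != r /\ x = p y.
Proof. by have [_ _ _ eS] := T_root => /eS; apply; rewrite in_setT. Qed.

Lemma parity_coloring : two_coloring [set x | odd (h x)].
Proof.
by move=> x y /edge_parent [] [/parent_height xr ->]; rewrite !inE xr /= ?negbK.
Qed.

(** Joining each non-root vertex to its parent yields every edge once; heights exclude that two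
    vertices are parents of each other. *)
Lemma card_rooted_tree : #|T| = #|edge_set T|.+1.
Proof.
have <-: [set [set x; p x] | x in [set~ r]] = edge_set T.
  apply/setP=> s; apply/imsetP/imsetP => [[x]|[[x y]]].
    rewrite !inE => /parent_edge xp ->.
    by exists (x, p x); rewrite ?inE.
  rewrite inE /= => /edge_parent [] [xr ->] ->.
    by exists x; rewrite ?inE.
  by exists y; rewrite ?inE // setUC.
rewrite card_in_imset ?cardsC1 ?prednK //; first by apply/card_gt0P; exists r.
move=> x y; rewrite !inE => xr yr xy; apply/eqP; apply: contraT => neq.
have /set2P [x_y|x_py] : x \in [set y; p y] by rewrite -xy set21.
  by rewrite x_y eqxx in neq.
have /set2P [y_x|y_px] : y \in [set x; p x] by rewrite xy set21.
  by rewrite y_x eqxx in neq.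
by have := parent_height xr; have := parent_height yr; rewrite -y_px -x_py; lia.
Qed.

(** [fconnect p x v] says that iterating [p] from [x] reaches [v], so [v] is among its own
    descendants. *)
Definition descendants v : {set T} := [set x | fconnect p x v].

Lemma descendants_refl v : v \in descendants v.
Proof. by rewrite inE connect0. Qed.

Lemma descendants_parent v x :
  x \in descendants v -> x != v -> p x \in descendants v.
Proof.
rewrite !inE => /connectP [[|y q] /= qP ->]; first by rewrite eqxx.
by case/andP: qP => /eqP -> yq _; apply/connectP; exists q.
Qed.

Lemma descendants_child v x : p x \in descendants v -> x \in descendants v.
Proof. by rewrite !inE; apply: connect_trans; apply: fconnect1. Qed.

Lemma descendants_height v x : x \in descendants v -> h v <= h x.
Proof.
rewrite inE => /iter_findex <-; elim: findex => //= n IHn.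
exact: leq_trans (parent_height_le _) IHn.
Qed.

Lemma descendants_root : descendants r = [set: T].
Proof.
apply/setP=> x; rewrite in_setT; have [n] := ubnP (h x).
elim: n x => // n IHn x ltn; have [->|xr] := eqVneq x r.
  exact: descendants_refl.
by apply: descendants_child; apply: IHn; move: ltn; rewrite (parent_height xr).
Qed.

Lemma parent_notin_descendants v : v != r -> p v \notin descendants v.
Proof.
by move=> /parent_height hv; apply/negP => /descendants_height; rewrite hv ltnn.
Qed.

Lemma descendants_split v x : x \in descendants v -> x != v ->
  exists u, [/\ u != r, p u = v & x \in descendants u].
Proof.
rewrite inE => /iter_findex; move: (findex p x v) => n xv neq.
elim: n v neq xv => [v neq /= xv|n IHn v neq /= xv].
  by rewrite xv eqxx in neq.
have [u_r|ur] := eqVneq (iter n p x) r.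
  by apply: IHn => //; rewrite -xv u_r parent_root.
exists (iter n p x); split=> //.
by rewrite inE; apply: fconnect_iter.
Qed.

Lemma card_children v : #|[set u | (u != r) && (p u == v)]| <= degree v.
Proof.
apply/subset_leq_card/subsetP => u; rewrite !inE => /andP [ur /eqP <-].
by rewrite edge_sym parent_edge.
Qed.

(* The vertices of A below v lie below the children of v, v itself excepted. *)
Lemma card_descendants_le A v d :
    (forall u, u != r -> p u = v -> #|A :&: descendants u| <= d) ->
  #|A :&: descendants v| <= (v \in A) + degree v * d.
Proof.
move=> ud; set J := [set u | (u != r) && (p u == v)].
have sub: A :&: descendants v \subset
    (A :&: [set v]) :|: \bigcup_(u in J) (A :&: descendants u).
  apply/subsetP=> x /setIP [xA xv]; rewrite in_setU in_setI xA in_set1.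
  have [//|neq] := eqVneq x v; have [u [ur puv xu]] := descendants_split xv neq.
  by apply/bigcupP; exists u; rewrite ?inE ?ur ?puv ?eqxx // xA; rewrite inE in xu.
apply: leq_trans (subset_leq_card sub) (leq_trans (leq_card_setU _ _) _).
rewrite leq_add //.
  case vA: (v \in A) => /=; first by rewrite -(cards1 v) subset_leq_card ?subsetIr.
  rewrite leqn0 cards_eq0; apply/eqP/setP=> x; rewrite !inE.
  by apply/negbTE; apply: contraFN vA => /andP [xA /eqP <-].
apply: leq_trans (card_bigcup_le (d := d) _) (leq_mul (card_children v) (leqnn d)).
by move=> u; rewrite inE => /andP [ur /eqP]; apply: ud.
Qed.

End RootedTreeTheory.

Lemma card_tree (T : sgraph) : is_tree T -> #|T| = #|edge_set T|.+1.
Proof.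
move=> T_tree; have [[/card_gt0P [r _] _] _] := T_tree.
by have [p [h T_root]] := rooted_tree r T_tree; apply: card_rooted_tree T_root.
Qed.

(** * Two-colourings and the degree sum of a colour class *)

Section ColoredGraph.
Variables (T : sgraph) (A : {set T}).
Hypothesis A_col : two_coloring A.

Lemma two_coloringC : two_coloring (~: A).
Proof. by move=> x y /A_col; rewrite !inE => ->. Qed.

(** Each edge has exactly one end in [A], so orienting it away from that end counts it once. *)
Lemma sum_degree_color_class : \sum_(x in A) degree x = #|edge_set T|.
Proof.
pose E := [set e : T * T | (e.1 \in A) && edge e.1 e.2].
have <-: [set [set e.1; e.2] | e in E] = edge_set T.
  apply/setP=> s; apply/imsetP/imsetP => [[[x y]]|[[x y]]]; rewrite !inE /=.
    by case/andP=> xA xy ->; exists (x, y); rewrite ?inE.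
  move=> xy ->; case xA: (x \in A); first by exists (x, y); rewrite ?inE /= ?xA.
  exists (y, x); rewrite ?inE /= ?[edge y x]edge_sym ?xy 1?setUC // andbT.
  by apply: contraFT xA => yA; rewrite (A_col xy).
rewrite card_in_imset => [|[x y] [x' y']].
  rewrite -sum1dep_card -(pair_big_dep (mem A) (fun x y => edge x y) (fun _ _ => 1)) /=.
  by apply: eq_bigr => x _; rewrite sum1dep_card.
rewrite !inE /= => /andP [xA xy] /andP [xA' xy'] /setP eqs.
have yA: y \notin A by rewrite -(A_col xy).
have yA': y' \notin A by rewrite -(A_col xy').
have neq a b : a \in A -> b \notin A -> (a == b) = false.
  by move=> aA; apply: contraNF => /eqP <-.
have := eqs x; have := eqs y; rewrite !inE !eqxx orbT (neq x y') // orbF.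
by rewrite eq_sym neq //= => /esym/eqP -> /esym/eqP ->.
Qed.

End ColoredGraph.

(** * Partial embeddings and their extension *)

Section PartialEmbedding.
Variables T G : sgraph.
Implicit Types (S : {set T}) (f g : T -> G).

Definition pembedding S f :=
  {in S &, injective f} /\ {in S &, forall x y, edge x y -> edge (f x) (f y)}.

Definition update f v w : T -> G := fun x => if x == v then w else f x.

Lemma update_eq f v w : update f v w v = w.
Proof. by rewrite /update eqxx. Qed.

Lemma update_neq f v w x : x != v -> update f v w x = f x.
Proof. by rewrite /update => /negPf ->. Qed.

Lemma update_notin S f v w x : v \notin S -> x \in S -> update f v w x = f x.
Proof. by move=> vS xS; apply: update_neq; apply: contraNneq vS => <-. Qed.

Lemma update_imset S f v w :
  v \notin S -> update f v w @: (v |: S) = w |: f @: S.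
Proof.
move=> vS; rewrite imsetU1 update_eq; congr (_ |: _).
by apply: eq_in_imset => x xS; rewrite (update_notin _ _ vS).
Qed.

Lemma pembedding_update S f v w :
    pembedding S f -> v \notin S -> w \notin f @: S ->
    (forall u, u \in S -> edge v u -> edge w (f u)) ->
  pembedding (v |: S) (update f v w).
Proof.
move=> [f_inj f_edge] vS wS vw.
have wf u : u \in S -> w != f u by move=> uS; apply: contraNneq wS => ->; rewrite imset_f.
split=> x y /setU1P [->|xS] /setU1P [->|yS];
  rewrite ?update_eq ?(update_notin _ _ vS) //.
- by move/eqP; rewrite (negPf (wf _ yS)).
- by move/esym/eqP; rewrite (negPf (wf _ xS)).
- exact: f_inj.
- by rewrite edge_irr.
- exact: vw.
- by rewrite edge_sym => /(vw x xS); rewrite edge_sym.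
- exact: f_edge.
Qed.

Lemma pembedding_empty f : pembedding set0 f.
Proof. by split=> x y; rewrite in_set0. Qed.

Lemma eq_pembedding S f g : {in S, f =1 g} -> pembedding S f -> pembedding S g.
Proof.
move=> fg [f_inj f_edge]; split=> x y xS yS; rewrite -!fg //.
  exact: f_inj.
exact: f_edge.
Qed.

(** The vertex added in a step may lie outside [U]; the process ends because [S] grows inside the
    finite tree. *)
Lemma greedy_extension (I : {set T} -> (T -> G) -> Prop) (U S : {set T}) f :
    I S f ->
    (forall S f, I S f -> ~~ (U \subset S) ->
       exists v w, v \notin S /\ I (v |: S) (update f v w)) ->
  exists S' f', I S' f' /\ U \subset S'.
Proof.
move=> ISf step; have [n] := ubnP #|~: S|.
elim: n S f ISf => // n IHn S f ISf ltn.
have [US|US] := boolP (U \subset S); first by exists S, f.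
have [v [w [vS Ivw]]] := step S f ISf US.
apply: IHn Ivw _; rewrite -ltnS; apply: leq_trans ltn.
rewrite ltnS proper_card // /proper !setCS subsetUr /=.
by apply: contra vS => /subsetP; apply; rewrite setU11.
Qed.

Lemma pembedding_contains_copy f : pembedding [set: T] f -> contains_copy G T.
Proof.
case=> f_inj0 f_edge0.
have f_inj : injective f by move=> x y; apply: f_inj0; rewrite in_setT.
have f_edge x y : edge x y -> edge (f x) (f y) by apply: f_edge0; rewrite in_setT.
(* The copy need not be induced: its edges are exactly the images of edges of [T], which turns [f]
   into an isomorphism. *)
pose e (u v : G) := [exists x, exists y, [&& edge x y, f x == u & f y == v]].
have eP u v : reflect (exists x y, [/\ edge x y, f x = u & f y = v]) (e u v).
  apply: (iffP existsP) => [[x /existsP [y /and3P [xy /eqP xu /eqP yv]]]|].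
    by exists x, y.
  by case=> x [y [xy <- <-]]; exists x; apply/existsP; exists y; rewrite xy !eqxx.
have e_sym : symmetric e.
  by move=> u v; apply/eP/eP => -[x [y [xy xu yv]]]; exists y, x; rewrite edge_sym.
have e_sub : subrel e (@edge G) by move=> u v /eP [x [y [xy <- <-]]]; exact: f_edge.
have e_vertex u v : e u v -> u \in f @: [set: T].
  by case/eP => x [y [_ <- _]]; rewrite imset_f ?in_setT.
pose H := Subgraph e_sym e_sub e_vertex.
have fH x : f x \in sub_vertex H by rewrite imset_f ?in_setT.
exists H, (fun x => exist _ (f x) (fH x)); split.
  have inv (u : H) : exists x, f x == val u.
    by case: u => u /= /imsetP [x _ ->]; exists x.
  exists (fun u => xchoose (inv u)) => [x|u].
    by apply: f_inj; apply/eqP; apply: (xchooseP (inv _)).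
  by apply: val_inj; apply/eqP; apply: (xchooseP (inv u)).
move=> x y; apply/eP/idP => /= [[x' [y' [xy /f_inj <- /f_inj <-]]]//|xy].
by exists x, y.
Qed.

End PartialEmbedding.

(** * Completing an admissible partial embedding *)

Section Extension.
Variables T G : sgraph.
Variables (A : {set T}) (X Y R : {set G}) (Delta D d : nat).
Hypotheses (A_col : two_coloring A) (T_deg : forall x : T, degree x <= Delta).
Hypothesis R_X : forall z, z \in R -> #|X :\: nbr z| <= D.
Hypothesis X_Y : forall x, x \in X -> #|Y :\: nbr x| <= d.
Hypothesis Y_big : #|T| + Delta * d <= #|Y|.
Implicit Types (S V : {set T}) (f g : T -> G).

(* The colour class A is destined for X.  An admissible partial embedding can
   only be continued through vertices outside A that it maps into R. *)
Definition admissible S f :=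
  [/\ pembedding S f,
      forall a, a \in A -> a \in S -> nbr a \subset S &
      forall c, c \notin A -> c \in S -> ~~ (nbr c \subset S) -> f c \in R].

(* f uses at least i fewer vertices of X than a map sending A :&: S into X. *)
Definition gain i S f := #|f @: S :&: X| + i <= #|A :&: S|.

Lemma card_boundary S : #|\bigcup_(c in S) nbr c| <= #|S| * Delta.
Proof. by apply: card_bigcup_le => c _; apply: T_deg. Qed.

Lemma card_embedded_nbrs S f v : #|f @: (S :&: nbr v)| <= Delta.
Proof.
apply: leq_trans (leq_imset_card _ _) _.
by apply: leq_trans (subset_leq_card (subsetIr _ _)) (T_deg v).
Qed.

(** Three greedy rounds: the vertices of [A] adjacent to [S] go to common neighbours in [X] of
    vertices of [R]; the rest of [A] goes anywhere into [X], where the gain guarantees room; the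
    remaining vertices go to common neighbours in [Y]. *)
Lemma admissible_extends S f :
    admissible S f -> gain (#|A| - #|X|) S f ->
    #|S| * Delta.+1 + Delta * D < #|X| ->
  exists f', pembedding [set: T] f'.
Proof.
move=> [f_emb A_S C_S] f_gain ltX.
pose U := A :&: \bigcup_(c in S) nbr c.
(* In the first two rounds only vertices of [A] are added, and they all go into [X]. *)
pose I S' f' := [/\ S \subset S', pembedding S' f', {in S, f' =1 f},
  S' :\: S \subset A & {in S' :\: S, forall a, f' a \in X}].
have I_step S' f' v w : I S' f' -> v \in A -> v \notin S' -> w \in X ->
    w \notin f' @: S' -> (forall u, u \in S' -> edge v u -> edge w (f' u)) ->
    I (v |: S') (update f' v w).
  move=> [SS' f'_emb f'_f S'A S'X] vA vS' wX wS' vw; split.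
  - by rewrite (subset_trans SS') ?subsetUr.
  - exact: pembedding_update.
  - by move=> x xS; rewrite (update_notin _ _ vS') ?f'_f ?(subsetP SS').
  - apply/subsetP => x; rewrite !inE => /andP [xS /orP [/eqP -> //|xS']].
    by apply: (subsetP S'A); rewrite inE xS.
  - move=> x; rewrite !inE => /andP [xS /orP [/eqP ->|xS']].
      by rewrite update_eq.
    by rewrite (update_notin _ _ vS') // S'X // inE xS.
have nbrA S' f' v u : I S' f' -> v \in A -> u \in S' -> edge v u -> u \in S.
  move=> [_ _ _ S'A _] vA uS' vu; apply: contraTT vA => uS.
  by rewrite (A_col vu) negbK; apply: (subsetP S'A); rewrite inE uS.
have [S1 [f1 [[I1 S1U] US1]]] : exists S1 f1,
    (I S1 f1 /\ S1 \subset S :|: U) /\ U \subset S1.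
  apply: (@greedy_extension _ _ (fun S1 f1 => I S1 f1 /\ S1 \subset S :|: U) _ S f).
    by rewrite /I subxx subsetUl setDv sub0set; split=> //; split=> // x; rewrite inE.
  move=> {}S1 {}f1 [I1 S1U] /subsetPn [v vU vS1].
  have [vA _] := setIP vU; have [SS1 f1_emb f1_f S1A S1X] := I1.
  pose W := f1 @: (S1 :&: nbr v).
  have [w [wX wS1 wW]] :
      exists w, [/\ w \in X, w \notin f1 @: S1 & forall z, z \in W -> edge z w].
    apply: (@exists_common_neighbour _ _ _ _ D).
      move=> z /imsetP [u /setIP [uS1]]; rewrite in_nbr => vu ->; apply: R_X.
      have uS := nbrA _ _ _ _ I1 vA uS1 vu; rewrite f1_f //; apply: C_S => //.
        by rewrite (A_col (edge_symP vu)) vA.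
      apply: contra vS1 => /subsetP uS'; rewrite (subsetP SS1) //; apply: uS'.
      by rewrite in_nbr edge_sym.
    apply: leq_ltn_trans ltX; rewrite mulnS leq_add //; last first.
      by rewrite leq_mul2r card_embedded_nbrs orbT.
    apply: leq_trans (leq_imset_card _ _) (leq_trans (subset_leq_card S1U) _).
    apply: leq_trans (leq_card_setU _ _) _; rewrite leq_add2l.
    exact: leq_trans (subset_leq_card (subsetIr _ _)) (card_boundary S).
  exists v, w; split=> //; split.
    apply: I_step => // u uS1 vu; rewrite edge_sym; apply: wW.
    by rewrite imset_f // inE uS1 in_nbr.
  by rewrite subUset sub1set in_setU vU orbT.
(* A vertex of [A] still missing has no embedded neighbour, since such a neighbour would lie in [S]
   and put the vertex into [U]. Only a free vertex of [X] is required. *)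
have [S2 [f2 [[I2 S12] AS2]]] : exists S2 f2, (I S2 f2 /\ U \subset S2) /\ A \subset S2.
  apply: (@greedy_extension _ _ (fun S2 f2 => I S2 f2 /\ U \subset S2) _ S1 f1) => //.
  move=> S2 f2 [I2 US2] /subsetPn [v vA vS2].
  have [SS2 f2_emb f2_f S2A S2X] := I2.
  have [w wX wS2] : exists2 w, w \in X & w \notin f2 @: S2.
    suff: #|f2 @: S2 :&: X| < #|X|.
      move/exists_notin => [w wX]; rewrite inE wX andbT => wS2.
      by exists w.
    have sub: f2 @: S2 :&: X \subset (f @: S :&: X) :|: f2 @: (S2 :\: S).
      apply/subsetP => z /setIP [/imsetP [x xS2 ->] fxX]; rewrite in_setU.
      have [xS|xS] := boolP (x \in S).
        by rewrite in_setI fxX f2_f // imset_f.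
      by rewrite orbC imset_f // inE xS.
    have := leq_trans (subset_leq_card sub) (leq_card_setU _ _).
    have := leq_imset_card f2 (S2 :\: S).
    have: #|S2 :\: S| < #|A :\: S|.
      apply: proper_card; apply/properP; split.
        by apply/subsetP => x xS2; rewrite inE (subsetP S2A) // andbT; case/setDP: xS2.
      exists v; last by rewrite inE negb_and vS2 orbT.
      by rewrite inE vA andbT; apply: contra vS2; apply: (subsetP SS2).
    by move: f_gain; rewrite /gain; have := cardsID S A; lia.
  exists v, w; split=> //; split; last by rewrite (subset_trans US2) ?subsetUr.
  apply: I_step => // u uS2 vu; case/negP: vS2; apply: (subsetP US2).
  rewrite inE vA; apply/bigcupP; exists u; last by rewrite in_nbr edge_sym.
  exact: nbrA I2 vA uS2 vu.
have [SS2 f2_emb f2_f S2A S2X] := I2.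
have [S3 [f3 [[SS3 f3_emb f3_f] TS3]]] : exists S3 f3,
    [/\ S2 \subset S3, pembedding S3 f3 & {in S2, f3 =1 f2}] /\ [set: T] \subset S3.
  apply: (@greedy_extension _ _
    (fun S3 f3 => [/\ S2 \subset S3, pembedding S3 f3 & {in S2, f3 =1 f2}]) _ S2 f2) => //.
  move=> S3 f3 [S23 f3_emb f3_f2] /subsetPn [v _ vS3].
  have [w [wY wS3 wW]] : exists w, [/\ w \in Y, w \notin f3 @: S3 &
      forall z, z \in f3 @: (S3 :&: nbr v) -> edge z w].
    apply: (@exists_common_neighbour _ _ _ _ d).
      move=> z /imsetP [u /setIP [uS3]]; rewrite in_nbr => vu ->; apply: X_Y.
      (* The neighbours of [v] lie in [A], and none is in [S], as admissibility would then place [v]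
         in [S]; so their images are in [X]. *)
      have uA : u \in A.
        rewrite (A_col (edge_symP vu)); apply: contra vS3 => vA.
        by rewrite (subsetP S23) ?(subsetP AS2).
      have uS2 := subsetP AS2 u uA; rewrite f3_f2 //; apply: S2X.
      rewrite inE uS2 andbT; apply: contra vS3 => uS.
      apply: (subsetP S23); apply: (subsetP SS2).
      by apply: (subsetP (A_S u uA uS)); rewrite in_nbr edge_sym.
    apply: leq_trans Y_big; rewrite -addSn leq_add //.
      apply: leq_ltn_trans (leq_imset_card _ _) _; rewrite -cardsT proper_card //.
      by apply/properP; split; [exact: subsetT|exists v].
    by rewrite leq_mul2r card_embedded_nbrs orbT.
  exists v, w; split=> //; split.
  - by rewrite (subset_trans S23) ?subsetUr.
  - apply: pembedding_update => // u uS3 vu; rewrite edge_sym; apply: wW.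
    by rewrite imset_f // inE uS3 in_nbr.
  - move=> x xS2; rewrite (update_notin _ _ vS3) ?f3_f2 //.
    exact: (subsetP S23).
exists f3; have -> // : [set: T] = S3.
by apply/eqP; rewrite eqEsubset TS3 subsetT.
Qed.

(** No edge joins [S] to [V]: its end in [A] would have all its neighbours in its own set. Hence the
    two maps can be glued and their gains add up. *)
Lemma admissible_union S f V g i :
    admissible S f -> admissible V g -> [disjoint S & V] ->
    [disjoint f @: S & g @: V] -> gain i S f -> gain 1 V g ->
  exists f', [/\ admissible (S :|: V) f', gain i.+1 (S :|: V) f' &
    f' @: (S :|: V) = f @: S :|: g @: V].
Proof.
move=> [f_emb A_S C_S] [g_emb A_V C_V] SV fgSV f_gain g_gain.
pose f' x := if x \in S then f x else g x.
have f'S : {in S, f' =1 f} by move=> x; rewrite /f' => ->.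
have VS x : x \in V -> (x \in S) = false.
  by move=> xV; rewrite disjoint_sym in SV; rewrite (disjointFr SV).
have f'V : {in V, f' =1 g} by move=> x /VS; rewrite /f' => ->.
have im: f' @: (S :|: V) = f @: S :|: g @: V.
  by rewrite imsetU (eq_in_imset f'S) (eq_in_imset f'V).
have noedge x y : x \in S -> y \in V -> edge x y -> False.
  move=> xS yV xy; have [xA|xA] := boolP (x \in A).
    have yS: y \in S by apply: (subsetP (A_S x xA xS)); rewrite in_nbr.
    by rewrite (VS y yV) in yS.
  have yA : y \in A by rewrite (A_col (edge_symP xy)).
  have xV : x \in V by apply: (subsetP (A_V y yA yV)); rewrite in_nbr edge_sym.
  by rewrite (VS x xV) in xS.
have [fS_inj fS_edge] := eq_pembedding (fun x xS => esym (f'S x xS)) f_emb.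
have [fV_inj fV_edge] := eq_pembedding (fun x xV => esym (f'V x xV)) g_emb.
have im_neq x y : x \in S -> y \in V -> f' x <> f' y.
  move=> xS yV; rewrite f'S // f'V // => fg.
  by have /(disjointFr fgSV) := imset_f f xS; rewrite fg imset_f.
exists f'; split=> //; last first.
  rewrite /gain im setIUl setIUr; move: f_gain g_gain; rewrite /gain.
  have ->: #|A :&: S :|: A :&: V| = #|A :&: S| + #|A :&: V|.
    apply/eqP; rewrite (leq_card_setU _ _) // disjoints_subset.
    by apply/subsetP => x; rewrite !inE => /andP [_ xS]; rewrite (disjointFr SV xS) andbF.
  by have := leq_of_leqif (leq_card_setU (f @: S :&: X) (g @: V :&: X)); clear; lia.
split.
- split=> x y /setUP [xS|xV] /setUP [yS|yV].
  + exact: fS_inj.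
  + by move/im_neq => /(_ xS yV).
  + by move/esym/im_neq => /(_ yS xV).
  + exact: fV_inj.
  + exact: fS_edge.
  + by move/noedge => /(_ xS yV).
  + by rewrite edge_sym => /noedge => /(_ yS xV).
  + exact: fV_edge.
- move=> a aA /setUP [aS|aV]; rewrite subsetU //.
    by rewrite A_S.
  by rewrite A_V // orbT.
- move=> c cA /setUP [cS|cV] sub.
    by rewrite f'S // C_S //; apply: contra sub => nc; rewrite subsetU // nc.
  by rewrite f'V // C_V //; apply: contra sub => nc; rewrite subsetU // nc orbT.
Qed.

End Extension.

(** * Gadgets *)

Section Gadgets.
Variables T G : sgraph.
Variables (A : {set T}) (X R R0 : {set G}) (Delta D : nat).
Hypotheses (A_col : two_coloring A) (T_deg : forall x : T, degree x <= Delta).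
Hypotheses (RX : [disjoint R & X]) (R0R : R0 \subset R).
Hypothesis R_X : forall z, z \in R -> #|X :\: nbr z| <= D.
Implicit Types (S V : {set T}) (U : {set G}).

Lemma nbr_color a x : x \in nbr a -> (x \in A) = (a \notin A).
Proof. by rewrite in_nbr => /edge_symP/A_col. Qed.

(** The leaf [a] goes to [u] and its neighbour to [v], so that no vertex of [X] is used for [a]. *)
Lemma leaf_gadget a u v :
    a \in A -> degree a = 1 -> u \in R0 -> v \in R0 -> edge u v ->
  exists g, [/\ admissible A R (a |: nbr a) g, gain A X 1 (a |: nbr a) g &
    g @: (a |: nbr a) = [set u; v]].
Proof.
rewrite degreeE => aA /eqP/cards1P [c a_c] uR vR uv.
have ca : c \in nbr a by rewrite a_c set11.
have cA : c \notin A by rewrite (nbr_color ca) aA.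
have ac : a \notin [set c] by rewrite in_set1; apply: contraNneq cA => <-.
pose g0 (_ : T) := v.
have g0c : g0 @: [set c] = [set v] by rewrite imset_set1.
have uneqv : u \notin [set v].
  by rewrite in_set1; apply: contraTneq uv => ->; rewrite edge_irr.
have nX z : z \in R0 -> z \notin X.
  by move=> zR; rewrite (disjointFr RX) ?(subsetP R0R).
exists (update g0 a u); rewrite a_c update_imset // g0c; split=> //.
  split.
  - apply: pembedding_update => //; last by rewrite g0c.
    by split=> x y /set1P -> /set1P ->; rewrite // edge_irr.
  - by move=> a' a'A /setU1P [->|/set1P a'c]; [rewrite a_c subsetUr|rewrite -a'c a'A in cA].
  - move=> c' c'A /setU1P [c'a|/set1P ->]; first by rewrite -c'a (negPf c'A) in aA.
    by rewrite (update_notin _ _ ac) ?set11 // (subsetP R0R).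
rewrite /gain update_imset // g0c.
have -> : [set u; v] :&: X = set0.
  apply/setP=> z; rewrite in_set0; apply/negbTE/negP => /setIP [/set2P zuv].
  by apply/negP; apply: nX; case: zuv => ->.
by rewrite cards0 card_gt0; apply/set0Pn; exists a; rewrite !inE aA eqxx.
Qed.

(** Here [z] is a hub hosting [a], and the neighbours of [a] go greedily to neighbours of [z] in
    [R0]. The set [U] collects the host vertices already in use. *)
Lemma star_gadget a z U :
    a \in A -> z \notin U -> z \notin X -> z \notin R0 ->
    #|U| + Delta < #|nbr z :&: R0| ->
  exists g, [/\ admissible A R (a |: nbr a) g, gain A X 1 (a |: nbr a) g,
    g @: (a |: nbr a) \subset z |: R0 & [disjoint U & g @: (a |: nbr a)]].
Proof.
move=> aA zU zX zR0 ltU.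
pose I S g := [/\ a \in S, S \subset a |: nbr a, pembedding S g, g a = z &
  forall c, c \in S -> c != a -> g c \in nbr z :&: R0 :\: U].
have nA c : c \in nbr a -> c \notin A by move/nbr_color ->; rewrite aA.
have neqa c : c \in nbr a -> c != a by move/nA; apply: contraNneq => ->.
have [S [g [[aS Sa g_emb ga gc] aS']]] :
    exists S g, I S g /\ nbr a \subset S.
  apply: (@greedy_extension _ _ I _ [set a] (fun=> z)).
    split=> //; rewrite ?set11 ?sub1set ?setU11 //.
      by split=> x y /set1P -> /set1P ->; rewrite // edge_irr.
    by move=> c /set1P ->; rewrite eqxx.
  move=> S g [aS Sa g_emb ga gc] /subsetPn [c ca cS].
  have [w wz wU] : exists2 w, w \in nbr z :&: R0 & w \notin U :|: g @: S.
    apply: exists_notin; apply: leq_ltn_trans (leq_card_setU _ _) _.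
    apply: leq_ltn_trans ltU; rewrite leq_add2l.
    apply: leq_trans (leq_imset_card _ _) _; rewrite -ltnS.
    apply: (@leq_trans #|a |: nbr a|).
      by apply: proper_card; apply/properP; split=> //; exists c; rewrite // setU1r.
    by rewrite cardsU1; have := T_deg a; rewrite degreeE; case: (a \notin _); lia.
  have [wU1 wS] : w \notin U /\ w \notin g @: S by apply/norP; rewrite in_setU in wU.
  exists c, w; split=> //; split.
  - by rewrite setU1r.
  - by rewrite subUset sub1set setU1r.
  - apply: pembedding_update => // u uS cu; case/setU1P: (subsetP Sa u uS) => [->|ua].
      by rewrite ga edge_sym; case/setIP: wz; rewrite in_nbr.
    by move: (A_col cu); rewrite (negPf (nA c ca)) (nA u ua).
  - by rewrite update_neq ?ga // eq_sym neqa.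
  - move=> c' /setU1P [-> _|c'S c'a]; first by rewrite update_eq inE wU1.
    by rewrite (update_notin _ _ cS) // gc.
have ->: a |: nbr a = S by apply/eqP; rewrite eqEsubset Sa subUset sub1set aS aS'.
have gS x : x \in S -> g x = z \/ g x \in nbr z :&: R0 :\: U.
  by move=> xS; have [->|xa] := eqVneq x a; [left|right; apply: gc].
exists g; split.
- split=> //.
    move=> b bA bS; case/setU1P: (subsetP Sa b bS) => [->//|/nA].
    by rewrite bA.
  move=> c cA cS _; have: c != a by apply: contraNneq cA => ->.
  by move/(gc c cS); rewrite !inE => /and3P [_ _ /(subsetP R0R)].
- rewrite /gain; have -> : g @: S :&: X = set0.
    apply/setP=> w; rewrite !inE; apply/negbTE/negP.
    case/andP => /imsetP [x xS ->]; case: (gS x xS) => [->|]; first by rewrite (negPf zX).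
    rewrite !inE => /and3P [_ _ /(subsetP R0R) xR].
    by rewrite (disjointFr RX xR).
  by rewrite cards0 card_gt0; apply/set0Pn; exists a; rewrite inE aA.
- apply/subsetP => w /imsetP [x xS ->]; case: (gS x xS) => [->|]; first by rewrite setU11.
  by rewrite !inE => /and3P [_ _ ->]; rewrite orbT.
- rewrite disjoint_sym disjoints_subset; apply/subsetP => w /imsetP [x xS ->].
  by rewrite in_setC; case: (gS x xS) => [->//|]; rewrite !inE => /and3P [].
Qed.

(** Only [c] is sent into [X], while the neighbours of [c], at least two vertices of [A], stay
    outside. Each of them is embedded together with its other neighbour on a fresh edge of [R0], and
    the image of [c] is chosen last. *)
Lemma flip_gadget c U N :
    acyclic T -> c \notin A -> 1 < degree c ->
    (forall a, a \in nbr c -> degree a = 2) ->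
    (forall U', #|U'| <= N -> exists u v, [/\ u \in R0 :\: U', v \in R0 :\: U' & edge u v]) ->
    #|U| + 2 * Delta <= N -> #|U| + 2 * Delta + Delta * D < #|X| ->
  let V := \bigcup_(a in nbr c) (a |: nbr a) in
  exists g, [/\ admissible A R V g, gain A X 1 V g,
    g @: V \subset X :|: R0 & [disjoint U & g @: V]].
Proof.
move=> acT cA c2 nbr2 fresh leN ltX V.
have nA a : a \in nbr c -> a \in A by move/nbr_color ->.
pose V0 (J : {set T}) := \bigcup_(a in J) ((a |: nbr a) :\ c).
have cV0 J : c \notin V0 J by apply/bigcupP => -[a _]; rewrite !inE eqxx.
have other a : a \in nbr c -> exists o,
    [/\ o \notin A, edge a o, o != c & nbr a = [set c; o]].
  move=> ac; have ca : c \in nbr a by rewrite in_nbr edge_sym -in_nbr.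
  have := nbr2 a ac; rewrite degreeE (cardsD1 c) ca => -[] /eqP/cards1P [o a_o].
  have : o \in nbr a :\ c by rewrite a_o set11.
  rewrite in_setD1 => /andP [oc oa]; exists o; split=> //.
  - by rewrite (nbr_color oa) nA.
  - by rewrite -in_nbr.
  - by rewrite -(setD1K ca) a_o.
have V0_card (J : {set T}) : J \subset nbr c -> #|V0 J| <= #|J| * 2.
  move=> Jc; apply: card_bigcup_le => a aJ; have [o [_ _ _ ->]] := other a (subsetP Jc a aJ).
  apply: (@leq_trans #|[set a; o]|); last by rewrite cards2; case: eqP.
  by apply/subset_leq_card/subsetP => x; rewrite !inE => /andP [/negPf -> /orP [->|]] //= ->; rewrite orbT.
have V0_in (J : {set T}) x : J \subset nbr c -> x \in V0 J ->
    exists2 b, b \in J & x = b \/ edge b x /\ x \notin A.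
  move=> Jc /bigcupP [b bJ]; rewrite !inE => /andP [_ /orP [/eqP ->|bx]]; exists b; auto.
  by right; split=> //; rewrite (A_col (edge_symP bx)) negbK nA ?(subsetP Jc).
(* A shared second neighbour would close a 4-cycle through [c]; hence the pairs to be embedded are
   disjoint and without edges between them. *)
have no4 a b o : a \in nbr c -> b \in nbr c -> a != b -> o != c -> edge a o -> edge b o -> False.
  rewrite !in_nbr => ca cb ab oc ao bo; apply: (acT [:: c; a; o; b]) => //.
  rewrite /ucycle /= ca ao (edge_symP bo) (edge_symP cb) /= !inE !negb_or /=.
  have neq (x y : T) : edge x y -> x != y by apply: contraTneq => ->; rewrite edge_irr.
  by rewrite (neq _ _ ca) (neq _ _ cb) (neq _ _ ao) ab [o == b]eq_sym (neq _ _ bo) eq_sym oc.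
have embed (J : {set T}) : J \subset nbr c ->
    exists g, pembedding (V0 J) g /\ g @: V0 J \subset R0 :\: U.
  have [n] := ubnP #|J|; elim: n J => // n IHn J ltn Jc.
  have [J0|/set0Pn [a aJ]] := eqVneq J set0.
    have [u _] : exists u : G, true.
      have [|u [_ _]] := fresh set0; first by rewrite cards0.
      by exists u.
    exists (fun=> u); rewrite /V0 J0 big_set0 imset0 sub0set.
    by split=> //; apply: pembedding_empty.
  pose J' := J :\ a.
  have J'c : J' \subset nbr c by rewrite (subset_trans (subsetDl _ _)).
  have [||g [g_emb gU]] := IHn J' => //; first by rewrite (cardsD1 a) aJ in ltn.
  have ac := subsetP Jc a aJ; have [o [oA ao oc a_co]] := other a ac.
  have aA := nA a ac.
  have [|u [v [uR vR uv]]] := fresh (U :|: g @: V0 J').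
    apply: leq_trans leN; apply: leq_trans (leq_card_setU _ _) _; rewrite leq_add2l.
    apply: leq_trans (leq_imset_card _ _) (leq_trans (V0_card _ J'c) _).
    rewrite mulnC leq_mul2l; apply: leq_trans (T_deg c).
    exact: subset_leq_card J'c.
  have V0J : V0 J = a |: (o |: V0 J').
    rewrite /V0 (big_setD1 a) //= a_co.
    have ca : c != a by apply: contraNneq cA => ->.
    apply/setP=> x; rewrite !inE.
    have [->|xc] := eqVneq x c; last by rewrite /= orbA.
    by rewrite (negPf ca) [c == o]eq_sym (negPf oc).
  have J'_neq b : b \in J' -> b \in nbr c /\ a != b.
    move=> bJ'; split; first exact: (subsetP J'c).
    by move: bJ'; rewrite !inE eq_sym => /andP [].
  have oV : o \notin V0 J'.
    apply/negP => /(V0_in _ _ J'c) [b bJ' [o_b|[bo _]]]; have [bc ab] := J'_neq b bJ'.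
      by rewrite o_b nA in oA.
    exact: (no4 a b o).
  have aV : a \notin o |: V0 J'.
    rewrite in_setU1 negb_or; apply/andP; split; first by apply: contraNneq oA => <-.
    apply/negP => /(V0_in _ _ J'c) [b bJ' [a_b|[_ /negP //]]]; have [bc ab] := J'_neq b bJ'.
    by rewrite a_b eqxx in ab.
  move: uR vR; rewrite !inE !negb_or => /andP [/andP [uU ug] uR] /andP [/andP [vU vg] vR].
  have oa : edge o a by apply: edge_symP.
  exists (update (update g o v) a u); rewrite V0J; split; last first.
    by rewrite !update_imset // !subUset !sub1set !inE uU uR vU vR.
  apply: pembedding_update => //; last 1 first.
  - move=> x xS ax; have : x \in nbr a by rewrite in_nbr.
    rewrite a_co => /set2P [x_c|->]; last by rewrite update_eq.
    move: xS; rewrite x_c in_setU1 eq_sym (negPf oc) /=.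
    by rewrite (negPf (cV0 J')).
  - apply: pembedding_update => // x /(V0_in _ _ J'c) [b bJ' [->|[_ xA]]] ox.
      have [bc ab] := J'_neq b bJ'; case: (no4 a b o) => //; exact: edge_symP.
    by have := A_col ox; rewrite (negPf oA) (negPf xA).
  rewrite update_imset // in_setU1 negb_or ug andbT.
  by apply: contraTneq uv => ->; rewrite edge_irr.
have [g [g_emb gU]] := embed _ (subxx (nbr c)).
have VV0 : V = c |: V0 (nbr c).
  apply/setP=> x; apply/bigcupP/setU1P => [[a ac xa]|[->|/bigcupP [a ac]]].
  - have [->|xc] := eqVneq x c; [by left|right].
    by apply/bigcupP; exists a; rewrite // in_setD1 xc.
  - have /card_gt0P [a ac] : 0 < #|nbr c| by apply: ltnW.
    by exists a; rewrite // setU1r // in_nbr edge_sym -in_nbr.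
  - by case/setD1P => _ xa; exists a.
(* The neighbours of [c] now sit on vertices of [R0], each missing at most [D] vertices of [X], so
   they have a common neighbour there. *)
have [w [wX wU wW]] : exists w, [/\ w \in X, w \notin U :|: g @: V0 (nbr c) &
    forall z, z \in g @: nbr c -> edge z w].
  apply: (@exists_common_neighbour _ _ _ _ D).
    move=> z /imsetP [a ac ->]; apply: R_X; apply: (subsetP R0R).
    have: g a \in R0 :\: U.
      apply: (subsetP gU); apply: imset_f; apply/bigcupP; exists a => //.
      by rewrite !inE eqxx andbT; apply: contraNneq cA => <-; apply: nA.
    by case/setDP.
  apply: leq_ltn_trans ltX; rewrite leq_add //.
    apply: leq_trans (leq_card_setU _ _) _; rewrite leq_add2l.
    apply: leq_trans (leq_imset_card _ _) (leq_trans (V0_card _ (subxx _)) _).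
    by rewrite mulnC leq_mul2l -degreeE T_deg.
  by rewrite leq_mul2r (leq_trans (leq_imset_card _ _) (T_deg c)) orbT.
move: wU; rewrite in_setU negb_or => /andP [wU wg].
have im : update g c w @: V = w |: g @: V0 (nbr c) by rewrite VV0 update_imset.
have imR : g @: V0 (nbr c) \subset R0 by rewrite (subset_trans gU) ?subsetDl.
have VA a : a \in A -> a \in V -> a \in nbr c.
  move=> aA /bigcupP [b bc /setU1P [->//|ab]].
  by have := nbr_color ab; rewrite aA nA.
exists (update g c w); split.
- split.
  + rewrite VV0; apply: pembedding_update => // x xV cx.
    rewrite edge_sym; apply: wW; apply: imset_f; rewrite in_nbr //.
  + by move=> a aA /(VA a aA) ac; apply: (bigcup_max a ac); apply: subsetUr.
  + move=> b bA; rewrite {1}VV0 => /setU1P [->|bV].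
      case/negP; apply/subsetP => a ac.
      by apply/bigcupP; exists a; rewrite ?setU11.
    move=> _; rewrite (update_notin _ _ (cV0 (nbr c))) //.
    by apply: (subsetP R0R); apply: (subsetP imR); apply: imset_f.
- rewrite /gain im; have sub: (w |: g @: V0 (nbr c)) :&: X \subset [set w].
    apply/subsetP => z /setIP [/setU1P [->|/(subsetP imR)/(subsetP R0R) zR]].
      by rewrite set11.
    by rewrite (disjointFr RX zR).
  have := subset_leq_card sub; rewrite cards1 => le1.
  have : #|nbr c| <= #|A :&: V|.
    apply/subset_leq_card/subsetP => a ac; rewrite in_setI nA //=.
    by apply/bigcupP; exists a; rewrite ?setU11.
  by move: c2; rewrite degreeE; lia.
- rewrite im subUset sub1set in_setU wX /=.
  by rewrite (subset_trans imR) ?subsetUr.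
- rewrite im disjoint_sym disjoints_subset subUset sub1set in_setC wU /=.
  by apply: subset_trans gU _; apply/subsetP => z /setDP [_]; rewrite in_setC.
Qed.

End Gadgets.

(** * Places for gadgets and pendant subtrees *)

Section TreePlaces.
Variables (T : sgraph) (A : {set T}) (Delta : nat).
Hypotheses (T_tree : is_tree T) (A_col : two_coloring A).
Hypothesis T_deg : forall x : T, degree x <= Delta.
Implicit Types S : {set T}.

Definition touched S := S :|: \bigcup_(s in S) nbr s.

Lemma card_touched S : #|touched S| <= #|S| * Delta.+1.
Proof.
apply: leq_trans (leq_card_setU _ _) _; rewrite mulnS leq_add2l.
by apply: card_bigcup_le => s _; apply: T_deg.
Qed.

Lemma disjoint_touched S a : a \notin touched S -> [disjoint S & a |: nbr a].
Proof.
rewrite in_setU negb_or => /andP [aS /bigcupP aN].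
rewrite disjoints_subset; apply/subsetP => x xS; rewrite !inE negb_or.
apply/andP; split; first by apply: contraNneq aS => <-.
by apply/negP => ax; case: aN; exists x; rewrite // in_nbr edge_sym.
Qed.

Lemma tree_degree_gt0 (x : T) : 1 < #|T| -> 0 < degree x.
Proof.
move=> T1; have [y] : exists y, y \notin [set x].
  have [|y _ yx] := @exists_notin T [set: T] [set x]; first by rewrite cardsT cards1.
  by exists y.
rewrite in_set1 eq_sym => xy; have [p [h /parent_edge/(_ _ xy) xp]] := rooted_tree y T_tree.
by apply/card_gt0P; exists (p x); rewrite inE.
Qed.

(** The set [[set a; c; c']] is closed under adjacency, so by connectedness it is all of [T]. *)
Lemma leaves_at_degree2 (a c c' : T) :
  nbr a = [set c; c'] -> degree c = 1 -> degree c' = 1 -> #|T| <= 3.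
Proof.
move=> a_cc c1 c'1; pose S := [set a; c; c'].
have leafS d : d \in nbr a -> degree d = 1 -> nbr d = [set a].
  move=> da /eqP/cards1P [b d_b]; have: a \in nbr d by rewrite in_nbr edge_sym -in_nbr.
  by rewrite /nbr d_b => /set1P ->.
have S_closed x y : x \in S -> edge x y -> y \in S.
  rewrite -in_nbr => /setUP [/set2P [->|->]|/set1P ->].
  - by rewrite a_cc !inE => /orP [->|->]; rewrite !orbT.
  - by rewrite leafS ?a_cc ?set21 // !inE => ->.
  - by rewrite leafS ?a_cc ?set22 // !inE => ->.
have -> : #|T| = #|S|.
  rewrite -cardsT; congr #|pred_of_set _|; apply/esym/setP => y; rewrite in_setT.
  suff walk q x : x \in S -> path (@edge T) x q -> last x q \in S.
    case: T_tree => -[_ /(_ a y) /connectP [q qP ->]] _.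
    by apply: walk qP; rewrite !inE eqxx.
  elim: q x => //= b q IHq x xS /andP [xb]; apply: IHq; exact: S_closed xb.
apply: leq_trans (leq_card_setU _ _) _; rewrite cards1 cards2; by case: (a != c).
Qed.

Lemma star_place S : #|S| * Delta.+1 < #|A| ->
  exists2 a, a \in A & [disjoint S & a |: nbr a].
Proof.
move=> ltA; have [a aA aS] := exists_notin (leq_ltn_trans (card_touched S) ltA).
by exists a => //; apply: disjoint_touched.
Qed.

(** If all leaves in [A] lie near [S], there are few of them, and the degree sum over [A] then
    bounds the vertices of degree at least 3. Far from all of these, every vertex of [A] has degree
    2. *)
Lemma edge_gadget_place S b :
    3 < #|T| -> #|edge_set T| <= 2 * #|A| + b ->
    (2 * (#|S| * Delta.+1) + b) * (Delta ^ 2).+1 < #|A| ->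
  (exists a, [/\ a \in A, degree a = 1 & [disjoint S & a |: nbr a]]) \/
  (exists c, [/\ c \notin A, 1 < degree c,
     forall a, a \in nbr c -> degree a = 2 &
     [disjoint S & \bigcup_(a in nbr c) (a |: nbr a)]]).
Proof.
move=> T3 bA ltA; have deg_gt0 x := @tree_degree_gt0 x (ltnW (ltnW T3)).
have [/existsP [a /and3P [aA aS /eqP a1]]|] :=
    boolP [exists a, [&& a \in A, a \notin touched S & degree a == 1]].
  by left; exists a; split=> //; apply: disjoint_touched.
rewrite negb_exists => /forallP noleaf; right.
pose A1 := [set a in A | degree a == 1].
pose A3 := [set a in A | 2 < degree a].
have A1_le : #|A1| <= #|S| * Delta.+1.
  apply: leq_trans (card_touched S); apply/subset_leq_card/subsetP => a.
  rewrite inE => /andP [aA a1]; have := noleaf a.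
  by rewrite aA a1 andbT /= negbK.
have A3_le : #|A3| <= #|A1| + b.
  (* Sum the inequality [2 + (2 < degree a) <= degree a + (degree a == 1)] over [A]. *)
  suff: 2 * #|A| + #|A3| <= #|edge_set T| + #|A1| by lia.
  rewrite -(sum_degree_color_class A_col) mulnC -sum_nat_const.
  have cardE (P : pred T) : #|[set a in A | P a]| = \sum_(a in A) P a.
    by rewrite -sum1_card big_mkcond [RHS]big_mkcond /=; apply: eq_bigr => a _;
      rewrite inE; case: (a \in A); case: (P a).
  rewrite !cardE -!big_split /=; apply: leq_sum => a _.
  by have := deg_gt0 a; case: (degree a) => [|[|[|n]]].
pose bad := touched S :|: A3.
have bad_le : #|bad| <= 2 * (#|S| * Delta.+1) + b.
  apply: leq_trans (leq_card_setU _ _) _.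
  by have := card_touched S; lia.
(* Excluding all vertices within distance two of [bad] makes [a] and every vertex of [A] at distance
   two from it have degree 2. *)
pose bad2 := bad :|: \bigcup_(x in bad) \bigcup_(c in nbr x) nbr c.
have [a aA abad2] : exists2 a, a \in A & a \notin bad2.
  apply: exists_notin; apply: leq_ltn_trans ltA.
  apply: (@leq_trans (#|bad| * (Delta ^ 2).+1)); last by rewrite leq_mul2r bad_le orbT.
  apply: leq_trans (leq_card_setU _ _) _; rewrite mulnS leq_add2l.
  apply: card_bigcup_le => x _; rewrite -mulnn.
  apply: leq_trans (@card_bigcup_le _ _ _ _ Delta _) _; first by move=> c _; apply: T_deg.
  by rewrite leq_mul2r T_deg orbT.
have [abad nbad] : a \notin bad /\ forall c, edge a c ->
    forall x, edge c x -> x \notin bad.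
  move: abad2; rewrite in_setU negb_or => /andP [-> /bigcupP no]; split=> // c ac x cx.
  apply/negP => xbad; apply: no; exists x => //.
  by apply/bigcupP; exists c; rewrite in_nbr edge_sym.
have good_deg x : x \in A -> x \notin bad -> degree x = 2.
  move=> xA; rewrite !inE !negb_or -/(touched S) xA /= => /andP [xS x3].
  have := noleaf x; rewrite xA /= negb_and negbK.
  have -> : (x \in touched S) = false by apply/negbTE; rewrite !inE negb_or.
  by have := deg_gt0 x; move: x3; case: (degree x) => [|[|[|n]]].
have [c ac c2] : exists2 c, edge a c & 1 < degree c.
  have /eqP/cards2P [c [c' [_ a_cc]]] := good_deg a aA abad.
  have ac : edge a c by rewrite -in_nbr /nbr a_cc set21.
  have ac' : edge a c' by rewrite -in_nbr /nbr a_cc set22.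
  have [c2|c1] := ltnP 1 (degree c); first by exists c.
  have [c'2|c'1] := ltnP 1 (degree c'); first by exists c'.
  have := @leaves_at_degree2 a c c' a_cc; have := deg_gt0 c; have := deg_gt0 c'.
  by lia.
have cA : c \notin A by rewrite -(A_col ac).
exists c; split=> // [x cx|].
  apply: good_deg; last by apply: (nbad c ac); rewrite -in_nbr.
  by rewrite (nbr_color A_col cx).
apply/bigcup_disjointP => x cx.
apply: disjoint_touched; have := nbad c ac x; rewrite -in_nbr cx => /(_ isT).
by rewrite in_setU negb_or => /andP [].
Qed.

End TreePlaces.

(** * Pendant subtrees and their embedding *)

Section Branch.
Variables (T : sgraph) (r : T) (p : T -> T) (h : T -> nat).
Hypothesis T_root : rooted_on [set: T] r p h.
Variables (A : {set T}) (Delta : nat).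
Hypotheses (A_col : two_coloring A) (T_deg : forall x : T, degree x <= Delta).

Lemma root_notin_descendants v : v != r -> r \notin descendants p v.
Proof.
rewrite inE => vr; apply: contra vr => /iter_findex <-.
by elim: findex => //= n /eqP ->; rewrite (parent_root T_root).
Qed.

Lemma nbr_descendants v x y :
  x \in descendants p v -> edge x y -> y \in p v |: descendants p v.
Proof.
move=> xv /(edge_parent T_root) [[_ ->]|[_ x_py]]; last first.
  by rewrite setU1r // descendants_child // -x_py.
have [->|neq] := eqVneq x v; first by rewrite setU11.
by rewrite setU1r // descendants_parent.
Qed.

(** As [v] is in [A], a descendant outside [A] has its parent among the descendants in [A], and each
    of those has at most [Delta] neighbours. *)
Lemma card_descendants_color v : v != r -> v \in A ->
  #|descendants p v| <= #|A :&: descendants p v| * Delta.+1.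
Proof.
move=> vr vA; rewrite mulnS -(cardsID A) setIC leq_add2l.
apply: leq_trans (@card_bigcup_le _ _ _ (@nbr T) Delta _); last by move=> a _; apply: T_deg.
apply/subset_leq_card/subsetP => x; rewrite in_setD => /andP [xA xv].
have xr : x != r by apply: contraTneq xv => ->; apply: root_notin_descendants.
have xpx := parent_edge T_root xr.
apply/bigcupP; exists (p x); last by rewrite in_nbr edge_sym.
rewrite in_setI (A_col (edge_symP xpx)) xA descendants_parent //.
by apply: contraNneq xA => ->.
Qed.

(* Take v deepest in A with at least m descendants in A. *)
Lemma exists_branch m :
    0 < m -> 0 < Delta -> r \notin A -> Delta * m <= #|A| ->
  exists v, [/\ v != r, v \in A & m <= #|A :&: descendants p v| <= Delta ^ 2 * m].
Proof.
move=> m0 D0 rA mA.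
pose big v := [&& v != r, v \in A & m <= #|A :&: descendants p v|].
(* Otherwise every child of [r] has at most [m.-1] descendants in [A], and [A] has at most
   [Delta * m.-1] vertices. *)
have [v0 v0_big] : exists v, big v.
  apply/existsP; apply: contraT; rewrite negb_exists => /forallP small.
  have : #|A :&: descendants p r| <= (r \in A) + degree r * m.-1.
    apply: (card_descendants_le T_root) => u ur pu.
    have := small u; rewrite /big ur /=.
    have -> /= : u \in A by rewrite (A_col (parent_edge T_root ur)) pu.
    by lia.
  rewrite (descendants_root T_root) setIT (negPf rA) add0n.
  have : degree r * m.-1 <= Delta * m.-1 by rewrite leq_mul2r T_deg orbT.
  have : Delta * m.-1 < Delta * m by rewrite ltn_mul2l D0 ltn_predL.
  by lia.
case: (arg_maxnP h v0_big) => v /and3P [vr vA mv] v_max.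
exists v; rewrite vr vA mv; split=> //=.
have deep u : h v < h u -> u != r -> u \in A -> #|A :&: descendants p u| <= m.-1.
  move=> vu ur uA; have := v_max u; rewrite /big ur uA /=; case: ltnP; last by lia.
  by lia.
(* By maximality of the height, the grandchildren of [v] have at most [m.-1] descendants in [A]; two
   generations give at most [1 + Delta * (Delta * m.-1)]. *)
have := @card_descendants_le _ _ _ _ T_root A v (Delta * m.-1).
rewrite vA => le_v; apply: leq_trans (le_v _) _.
  move=> c cr pc; have hc := parent_height T_root cr; rewrite pc in hc.
  have cA : c \notin A.
    by rewrite -(A_col (edge_symP (parent_edge T_root cr))) pc.
  have := @card_descendants_le _ _ _ _ T_root A c m.-1.
  rewrite (negPf cA) add0n => le_c; apply: leq_trans (le_c _) _.
    move=> u ur pu; have hu := parent_height T_root ur; rewrite pu in hu.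
    apply: deep => //; first by lia.
    by rewrite (A_col (parent_edge T_root ur)) pu.
  by rewrite leq_mul2r T_deg orbT.
rewrite -mulnn -mulnA add1n; apply: (@leq_ltn_trans (Delta * (Delta * m.-1))).
  by rewrite leq_mul2r T_deg orbT.
by rewrite !ltn_mul2l D0 ltn_predL.
Qed.

(** The edge [y z] carries [p v] and [v]; below [v] the degrees inside [P] suffice to continue
    greedily without leaving [P]. *)
Lemma branch_embedding (G : sgraph) (P : {set G}) (y z : G) v s :
    v != r -> z \in P -> y \notin P -> edge y z -> #|descendants p v| <= s ->
    (forall w, w \in P -> s < #|nbr w :&: P|) ->
  exists f, [/\ pembedding (p v |: descendants p v) f, f (p v) = y &
    forall x, x \in descendants p v -> f x \in P].
Proof.
move=> vr zP yP yz desc_s P_deg; set V := p v |: _.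
have pvD := parent_notin_descendants T_root vr.
have v_pv : v != p v by apply: contraNneq pvD => <-; rewrite descendants_refl.
pose I (S : {set T}) (f : T -> G) := [/\ p v \in S /\ v \in S, S \subset V, pembedding S f,
  f (p v) = y & forall x, x \in S -> x != p v -> f x \in P /\ (x != v -> p x \in S)].
have [S [f [[[pvS vS] SV f_emb fpv fP] VS]]] : exists S f, I S f /\ V \subset S.
  apply: (@greedy_extension _ _ I _ [set p v; v] (update (fun=> z) (p v) y)).
    split.
    - by rewrite set21 set22.
    - by rewrite subUset !sub1set setU11 setU1r ?descendants_refl.
    - apply: pembedding_update.
      + by split=> a b /set1P -> /set1P ->; rewrite // edge_irr.
      + by rewrite in_set1 eq_sym.
      + by rewrite imset_set1 in_set1; apply: contraNneq yP => ->.
      + by move=> u /set1P ->.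
    - by rewrite update_eq.
    - move=> x /set2P [->|->]; first by rewrite eqxx.
      by rewrite update_neq // eqxx.
  move=> S f [[pvS vS] SV f_emb fpv fP] VS.
  (* A missing vertex of least height has its parent embedded already. *)
  have [x [xV xS x_min]] : exists x, [/\ x \in V, x \notin S &
      forall u, u \in V -> u \notin S -> h x <= h u].
    case/subsetPn: VS => x0 x0V x0S.
    have x0_ok : x0 \in V :\: S by rewrite inE x0S.
    case: (arg_minnP h x0_ok) => x /setDP [xV xS] x_min; exists x; split=> // u uV uS.
    by apply: x_min; apply/setDP.
  have x_pv : x != p v by apply: contraNneq xS => ->.
  have x_v : x != v by apply: contraNneq xS => ->.
  have xD : x \in descendants p v by case/setU1P: xV => // x_eq; rewrite x_eq eqxx in x_pv.
  have xr : x != r by apply: contraTneq xD => ->; apply: root_notin_descendants.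
  have pxD := descendants_parent xD x_v.
  have pxS : p x \in S.
    apply: contraT => pxS; have := x_min (p x) (setU1r _ pxD) pxS.
    by rewrite (parent_height T_root xr) ltnn.
  have px_pv : p x != p v by apply: contraNneq pvD => <-.
  have [fpxP _] := fP _ pxS px_pv.
  have [w wN wS] : exists2 w, w \in nbr (f (p x)) :&: P & w \notin f @: S.
    apply: exists_notin; apply: leq_ltn_trans (P_deg _ fpxP).
    apply: leq_trans (leq_imset_card _ _) (leq_trans _ desc_s).
    rewrite -ltnS; apply: (@leq_trans #|V|); last by rewrite cardsU1 pvD.
    by apply: proper_card; apply/properP; split=> //; exists x.
  case/setIP: wN; rewrite in_nbr => pxw wP.
  exists x, w; split=> //; split.
  - by rewrite !setU1r.
  - by rewrite subUset sub1set xV.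
  (* No child of [x] is embedded: [p v] is too high up in the tree, and all other embedded vertices
     have embedded parents. So only the edge to [p x] matters. *)
  - apply: pembedding_update => // u uS /(edge_parent T_root) [[_ ->]|[ur x_pu]].
      by rewrite edge_sym.
    have [u_pv|u_pv] := eqVneq u (p v).
      have := descendants_height T_root xD; rewrite x_pu u_pv.
      move/leq_trans/(_ (parent_height_le T_root (p v))).
      by rewrite (parent_height T_root vr) ltnn.
    have [u_v|u_v] := eqVneq u v; first by rewrite x_pu u_v eqxx in x_pv.
    by have [_ /(_ u_v)] := fP u uS u_pv; rewrite -x_pu (negPf xS).
  - by rewrite update_neq // eq_sym.
  - move=> u /setU1P [-> _|uS u_pv]; first by rewrite update_eq setU1r.
    have [fuP pu] := fP u uS u_pv; rewrite (update_notin _ _ xS) //.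
    by split=> // /pu puS; rewrite setU1r.
have SV_eq : V = S by apply/eqP; rewrite eqEsubset SV VS.
exists f; split=> // [|x xD]; first by rewrite SV_eq.
have xS : x \in S by rewrite -SV_eq setU1r.
by have [|//] := fP x xS; apply: contraNneq pvD => <-.
Qed.

End Branch.

(** * Counting in the host graph *)

Lemma sum_card_nbr (G : sgraph) (U W : {set G}) :
  \sum_(y in W) #|nbr y :&: U| = \sum_(u in U) #|nbr u :&: W|.
Proof.
have cardE (S : {set G}) x : #|nbr x :&: S| = \sum_(y in S) edge x y.
  rewrite -sum1_card big_mkcond [RHS]big_mkcond /=; apply: eq_bigr => y _.
  by rewrite !inE andbC; case: (y \in S); case: (edge x y).
under eq_bigr do rewrite cardE; under [RHS]eq_bigr do rewrite cardE.
rewrite exchange_big /=; apply: eq_bigr => u _; apply: eq_bigr => y _.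
by rewrite edge_sym.
Qed.

Lemma subset_of_card (I : finType) (S : {set I}) n :
  n <= #|S| -> exists2 S' : {set I}, S' \subset S & #|S'| = n.
Proof.
move=> leS; exists [set x in take n (enum S)].
  by apply/subsetP => x; rewrite inE => /mem_take; rewrite mem_enum.
rewrite cardsE (card_uniqP _) ?take_uniq ?enum_uniq // size_takel //.
by rewrite -cardE.
Qed.

(** * The embedding with integer parameters *)

Section Core.
Variables (T G : sgraph) (A : {set T}) (X Y : {set G}) (Delta k : nat).
(* s i stands for Delta ^ i * floor (eps k). *)
Variable s : nat -> nat.
Hypotheses (T_tree : is_tree T) (T_edges : #|edge_set T| = k).
Hypotheses (A_col : two_coloring A) (A_le : 2 * #|A| <= k.+1).
Hypothesis T_deg : forall x : T, degree x <= Delta.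
Hypothesis G_deg : forall v : G, k <= 2 * degree v.
Hypotheses (XY : [disjoint X & Y]) (Y_card : 6 * k <= #|Y|).
Hypothesis Y_X : forall y, y \in Y -> k <= 2 * #|X :&: nbr y| + s 0.
Hypotheses (Delta_gt0 : 0 < Delta) (s_gt0 : 0 < s 0).
Hypotheses (sS : forall i, Delta * s i = s i.+1) (k_ge : 1000 * s 4 <= k).

Let s_le i : s i <= s i.+1. Proof. by rewrite -sS leq_pmull. Qed.
Let s01 : s 0 <= s 1. Proof. exact: s_le. Qed.
Let s12 : s 1 <= s 2. Proof. exact: s_le. Qed.
Let s23 : s 2 <= s 3. Proof. exact: s_le. Qed.
Let s34 : s 3 <= s 4. Proof. exact: s_le. Qed.
Let Delta_s1 : Delta <= s 1. Proof. by rewrite -sS leq_pmulr. Qed.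

Variable d : nat.
Hypotheses (X_d : forall x, x \in X -> #|Y :\: nbr x| <= d).
Hypothesis Y_big : #|T| + Delta * d <= #|Y|.

Let T_card : #|T| = k.+1. Proof. by rewrite card_tree // T_edges. Qed.

Lemma extend_admissible (R : {set G}) D S (f : T -> G) :
    (forall z, z \in R -> #|X :\: nbr z| <= D) -> admissible A R S f ->
    gain A X (#|A| - #|X|) S f -> #|S| * Delta.+1 + Delta * D < #|X| ->
  exists f' : T -> G, pembedding [set: T] f'.
Proof. by move=> R_X; apply: (admissible_extends A_col T_deg R_X X_d Y_big). Qed.

Lemma admissible_empty (R : {set G}) (f : T -> G) : admissible A R set0 f.
Proof.
by split=> [|a _|c _]; rewrite ?in_set0 //; apply: pembedding_empty.
Qed.

Lemma exists_vertex : exists y, y \in Y.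
Proof. by apply/card_gt0P; lia. Qed.

Lemma embedding_small_color_class : #|A| <= #|X| ->
  exists f : T -> G, pembedding [set: T] f.
Proof.
move=> AX; have [y _] := exists_vertex.
apply: (@extend_admissible set0 0 set0 (fun=> y)).
- by move=> z; rewrite in_set0.
- exact: admissible_empty.
- by rewrite /gain imset0 set0I setI0 !cards0; lia.
rewrite cards0 muln0 mul0n; apply: leq_trans AX; rewrite card_gt0.
apply/eqP => A0; have := sum_degree_color_class A_col.
by rewrite A0 big_set0 T_edges; lia.
Qed.

Section LargeColorClass.
Hypothesis AX : #|X| < #|A|.

Let m := #|A| - #|X|.
(** A vertex outside [X] that is not rich has more than [9 * s 3] neighbours outside [X]; removing
    fewer than [6 * s 1] rich ones and at most [s 0] hubs leaves more than [2 * s 3]. *)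
Let D := 9 * s 3.
(** A hub must have room for a star after the loss of at most [3 * s 1] used vertices and [s 0]
    reserved hubs; the star itself needs at most [Delta <= s 1] places. *)
Let L := 6 * s 1.
Let Delta_D : Delta * D = 9 * s 4. Proof. by rewrite /D mulnCA sS. Qed.
Let mul_scale c i : c * s i * Delta.+1 = c * s i + c * s i.+1.
Proof. by rewrite mulnS -mulnA [s i * _]mulnC sS. Qed.

Let X_ge : k <= 2 * #|X| + s 0.
Proof.
have [y yY] := exists_vertex; have := Y_X yY.
by have := subset_leq_card (subsetIl X (nbr y)); lia.
Qed.

Let m_le : m <= s 0. Proof. by rewrite /m; lia. Qed.
Let m_gt0 : 0 < m. Proof. by rewrite /m; lia. Qed.

Definition rich : {set G} := [set z in ~: X | #|X :\: nbr z| <= D].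
Definition hubs : {set G} := [set z in ~: X | L <= #|nbr z :&: rich|].
Definition wild : {set G} := ~: (X :|: rich :|: hubs).

Let rich_X z : z \in rich -> #|X :\: nbr z| <= D.
Proof. by rewrite inE => /andP []. Qed.

Let rich_disj : [disjoint rich & X].
Proof.
by rewrite disjoints_subset; apply/subsetP => z; rewrite inE => /andP [].
Qed.

Let Y_rich : Y \subset rich.
Proof.
apply/subsetP => y yY; rewrite !inE (disjointFl XY yY) /=.
have := Y_X yY; have := cardsID (nbr y) X; have := X_ge.
by rewrite /D; lia.
Qed.

(** Rounding matters here: [#|A|] is at most, and [degree z] at least, half of [k] rounded up. *)
Lemma outside_degree z : m <= #|nbr z :\: X|.
Proof.
have := G_deg z; rewrite degreeE -(cardsID X (nbr z)).
by have := subset_leq_card (subsetIr (nbr z) X); rewrite /m; lia.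
Qed.

Lemma wild_degree w : #|hubs| < m -> w \in wild -> 2 * s 3 < #|nbr w :&: wild|.
Proof.
move=> Qm; rewrite !inE !negb_or => /andP [/andP [wX]].
rewrite wX /= -ltnNge -ltnNge => wR wQ.
have sub: nbr w \subset
    (X :&: nbr w) :|: ((nbr w :&: rich) :|: (hubs :|: (nbr w :&: wild))).
  apply/subsetP => z wz; rewrite !in_setU !in_setI wz /= andbT.
  rewrite in_setC !in_setU !negb_or.
  by case: (z \in X); case: (z \in rich); case: (z \in hubs).
have := G_deg w; rewrite degreeE.
have := subset_leq_card sub.
have := leq_of_leqif (leq_card_setU (X :&: nbr w) ((nbr w :&: rich) :|: (hubs :|: (nbr w :&: wild)))).
have := leq_of_leqif (leq_card_setU (nbr w :&: rich) (hubs :|: (nbr w :&: wild))).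
have := leq_of_leqif (leq_card_setU hubs (nbr w :&: wild)).
have := cardsID (nbr w) X.
by move: wR wQ; rewrite /D /L; lia.
Qed.

(** A pendant subtree with at least [m] vertices in [A] hangs from [y] into the wild vertices. It
    uses no vertex of [X], so it gains all of [m] at once. *)
Lemma embedding_escape y z : #|hubs| < m -> y \in rich -> z \in wild -> edge y z ->
  exists f : T -> G, pembedding [set: T] f.
Proof.
move=> Qm yR zW yz; have [r rA] : exists r, r \notin A.
  have [r _ rA] : exists2 r, r \in [set: T] & r \notin A.
    by apply: exists_notin; rewrite cardsT T_card; lia.
  by exists r.
have [p [h T_root]] := rooted_tree r T_tree.
have [|v [vr vA /andP [mv vm]]] := exists_branch T_root A_col T_deg m_gt0 Delta_gt0 rA.
  have : Delta * m <= s 1 by rewrite -sS leq_mul2l m_le orbT.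
  by lia.
have desc_le : #|descendants p v| <= 2 * s 3.
  apply: leq_trans (card_descendants_color T_root A_col T_deg vr vA) _.
  have : #|A :&: descendants p v| <= s 2.
    by rewrite (leq_trans vm) // -mulnn -mulnA -!sS !leq_mul2l m_le !orbT.
  move/(leq_mul)/(_ (leqnn Delta.+1))/leq_trans; apply.
  by rewrite mulnS mulnC sS mul2n -addnn leq_add2r.
clear vm.
have yW : y \notin wild by rewrite in_setC negbK !in_setU yR orbT.
have [f [f_emb fy fW]] := branch_embedding T_root vr zW yW yz desc_le
  (fun w => wild_degree Qm).
have pvA : p v \notin A.
  by rewrite -(A_col (parent_edge T_root vr)).
have wildX x : x \in wild -> x \notin X.
  by rewrite in_setC !in_setU !negb_or => /andP [/andP []].
apply: (extend_admissible rich_X (S := p v |: descendants p v) (f := f)).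
- split=> // [a aA /setU1P [a_pv|aD]|c cA /setU1P [->|cD]].
  + by rewrite a_pv (negPf pvA) in aA.
  + by apply/subsetP => x; rewrite in_nbr; apply: (nbr_descendants T_root aD).
  + by rewrite fy.
  + case/negP; apply/subsetP => x; rewrite in_nbr.
    exact: (nbr_descendants T_root cD).
- rewrite /gain -/m; have -> : f @: (p v |: descendants p v) :&: X = set0.
    apply/setP => x; rewrite in_set0; apply/negbTE/negP => /setIP [/imsetP [u uS ->]].
    apply/negP; case/setU1P: uS => [->|/fW/wildX//].
    by rewrite fy (disjointFr rich_disj yR).
  rewrite cards0 add0n; apply: leq_trans mv _.
  by apply/subset_leq_card/setIS/subsetUr.
have : #|p v |: descendants p v| <= 3 * s 3.
  rewrite cardsU1; move: desc_le s_gt0 s01 s12 s23 (leq_b1 (p v \notin descendants p v)).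
  by clear; lia.
move/(leq_mul)/(_ (leqnn Delta.+1)) => leS.
by move: leS (mul_scale 3 3) Delta_D X_ge k_ge s_gt0 s01 s12 s23 s34; clear; lia.
Qed.

(** * Making up the deficit with gadgets *)

Section Gadgets.
Variable Q : {set G}.
Hypotheses (Q_hubs : Q \subset hubs) (Q_le : #|Q| <= m).
(** A hub can itself be rich; removing [Q] reserves its vertices as centres of stars. *)
Let R0 := rich :\: Q.
Let q := m - #|Q|.
(* The case excluded by [embedding_escape]. *)
Hypothesis Q_all : 0 < q -> Q = hubs /\
  forall y z, y \in rich -> z \in wild -> ~~ edge y z.

(** Double counting: if [U] met every edge inside [R0], each of the at least [5 * k] vertices of [W]
    would have [q] neighbours in [U], while vertices of [U] in [R0] are no hubs and have fewer than
    [L] rich neighbours. *)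
Lemma fresh_edge (U : {set G}) : 0 < q -> #|U| <= 5 * Delta * q ->
  exists u v, [/\ u \in R0 :\: U, v \in R0 :\: U & edge u v].
Proof.
move=> q0 U_le; have [QQ noesc] := Q_all q0.
have [/existsP [u /existsP [v /and3P [uR vR uv]]]|] :=
    boolP [exists u, exists v, [&& u \in R0 :\: U, v \in R0 :\: U & edge u v]].
  by exists u, v.
move=> no; exfalso; pose W := Y :\: (Q :|: U).
have W_deg y : y \in W -> q <= #|nbr y :&: (U :&: R0)|.
  rewrite !inE negb_or => /andP [/andP [yQ yU] yY].
  have yR := subsetP Y_rich y yY.
  apply: (@leq_trans #|nbr y :\: X :\: Q|).
    have := cardsID Q (nbr y :\: X); have := outside_degree y.
    by have := subset_leq_card (subsetIr (nbr y :\: X) Q); rewrite /q; clear; lia.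
  apply/subset_leq_card/subsetP => z /setDP [/setDP [yz zX] zQ].
  (* A neighbour outside [X] and outside [Q = hubs] is rich or wild, and rich vertices have no wild
     neighbours here. *)
  have zR : z \in R0.
    rewrite inE zQ; apply: contraTT yz => zR; rewrite in_nbr.
    by apply: noesc => //; rewrite in_setC !in_setU -QQ !negb_or zX zR.
  rewrite in_setI yz in_setI zR andbT /=; apply: contraNT no => zU.
  apply/existsP; exists y; apply/existsP; exists z.
  have yR0 : y \in R0 by rewrite in_setD yQ.
  by apply/and3P; split; [apply/setDP|apply/setDP|rewrite -in_nbr].
have R0_deg u : u \in U :&: R0 -> #|nbr u :&: W| <= L.
  move=> /setIP [_ /setDP [uR]]; rewrite QQ inE negb_and -ltnNge.
  have uX : u \notin X by rewrite (disjointFr rich_disj uR).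
  rewrite in_setC uX /= => /ltnW; apply: leq_trans; apply/subset_leq_card/setIS.
  exact: subset_trans (subsetDl _ _) Y_rich.
have : #|W| * q <= #|U| * L.
  rewrite -[#|W| * q]sum_nat_const.
  apply: leq_trans (leq_sum _ W_deg) _; rewrite sum_card_nbr.
  apply: leq_trans (leq_sum _ R0_deg) _; rewrite sum_nat_const leq_mul2r.
  by rewrite subset_leq_card ?subsetIl ?orbT.
have qe : q <= s 0 by rewrite /q; lia.
have U5 : #|U| <= 5 * s 1.
  by apply: leq_trans U_le _; rewrite -mulnA -sS leq_mul2l leq_mul2l qe orbT.
have W_card : 5 * k <= #|W|.
  have := cardsID (Q :|: U) Y; have := subset_leq_card (subsetIr Y (Q :|: U)).
  have := leq_of_leqif (leq_card_setU Q U).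
  by rewrite -/W; lia.
have : #|U| * L <= 30 * s 2 * q.
  have -> : 30 * s 2 * q = 5 * Delta * q * L by rewrite /L -sS; clear; lia.
  by rewrite leq_mul2r U_le orbT.
have : 5 * k * q <= #|W| * q by rewrite leq_mul2r W_card orbT.
have : 30 * s 2 * q < 5 * k * q by rewrite ltn_mul2r q0; lia.
by lia.
Qed.

Let mul_le i : i <= m -> 3 * Delta * i <= 3 * s 1.
Proof. by move=> im; rewrite -mulnA -sS leq_mul2l leq_mul2l (leq_trans im) ?orbT. Qed.

Let S_X (S : {set T}) : #|S| <= 3 * s 1 -> #|S| * Delta.+1 + Delta * D < #|X|.
Proof.
move/(leq_mul)/(_ (leqnn Delta.+1)) => leS.
have := mul_scale 3 1.
by lia.
Qed.

Let star_card (a : T) : #|a |: nbr a| <= 3 * Delta.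
Proof. by rewrite cardsU1; have := T_deg a; rewrite degreeE; case: (_ \notin _); lia. Qed.

Let cardU_le (S V : {set T}) i :
  #|S| <= 3 * Delta * i -> #|V| <= 3 * Delta -> #|S :|: V| <= 3 * Delta * i.+1.
Proof.
move=> S_le V_le; apply: leq_trans (leq_card_setU _ _) _.
by rewrite mulnS addnC leq_add.
Qed.

Let R0_rich : R0 \subset rich. Proof. exact: subsetDl. Qed.

Lemma edge_gadgets i : i <= q -> exists S (f : T -> G),
  [/\ admissible A rich S f, gain A X i S f, #|S| <= 3 * Delta * i &
      f @: S \subset X :|: R0].
Proof.
elim: i => [_|i IHi ltiq].
  have [y _] := exists_vertex; exists set0, (fun=> y).
  rewrite /gain imset0 set0I setI0 !cards0 sub0set.
  by split=> //; apply: admissible_empty.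
have [S [f [f_adm f_gain S_le fXR]]] := IHi (ltnW ltiq).
have q_m : q <= m by apply: leq_subr.
have q0 : 0 < q by apply: leq_ltn_trans ltiq.
have S_e1 : #|S| <= 3 * s 1 := leq_trans S_le (mul_le (leq_trans (ltnW ltiq) q_m)).
have fS_le : #|f @: S| <= #|S| by apply: leq_imset_card.
(* The previous gadgets occupy at most [3 * Delta * i] vertices, and a flip asks for [2 * Delta]
   more; hence the 5 in [fresh_edge]. *)
have fS_fresh : #|f @: S| + 2 * Delta <= 5 * Delta * q.
  apply: (@leq_trans (3 * Delta * i.+1 + 2 * Delta * i.+1)).
    by rewrite !mulnS; move: S_le fS_le; clear; lia.
  by rewrite -mulnDl -mulnDl leq_mul2l ltiq orbT.
have conclude (V : {set T}) (g : T -> G) : [disjoint S & V] -> admissible A rich V g -> gain A X 1 V g ->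
    g @: V \subset X :|: R0 -> [disjoint f @: S & g @: V] -> #|V| <= 3 * Delta ->
    exists S (f : T -> G), [/\ admissible A rich S f, gain A X i.+1 S f,
      #|S| <= 3 * Delta * i.+1 & f @: S \subset X :|: R0].
  move=> SV g_adm g_gain gXR fg V_le.
  have [f' [f'_adm f'_gain f'_im]] := admissible_union A_col f_adm g_adm SV fg f_gain g_gain.
  by exists (S :|: V), f'; rewrite f'_im subUset fXR gXR; split=> //; apply: cardU_le.
(* The tree is almost balanced: [#|X| < #|A|] gives [k <= 2 * #|A| + s 0], so the excess [b] is
   [s 0]. *)
have [|||[a [aA a1 Sa]]|[c [cA c2 nbr2 Sc]]] :=
    @edge_gadget_place _ _ _ T_tree A_col T_deg S (s 0).
- by rewrite T_card; move: k_ge s_gt0 s01 s12 s23 s34; clear; lia.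
- by rewrite T_edges; move: X_ge AX; clear; lia.
- have : #|S| * Delta.+1 <= 6 * s 2.
    move: S_e1 => /(leq_mul)/(_ (leqnn Delta.+1)).
    by have := mul_scale 3 1; move: s12; clear; lia.
  move=> S6; apply: (@leq_ltn_trans (13 * s 2 * (Delta ^ 2).+1)).
    by rewrite leq_mul2r; apply/orP; right; move: S6 s_gt0 s01 s12 s23 s34; clear; lia.
  have -> : 13 * s 2 * (Delta ^ 2).+1 = 13 * s 2 + 13 * s 4.
    by rewrite mulnS -mulnn -!sS; clear; lia.
  by move: k_ge X_ge AX s_gt0 s01 s12 s23 s34; clear; lia.
- have [|u [v [uR vR uv]]] := @fresh_edge (f @: S) q0.
    exact: leq_trans (leq_addr _ _) fS_fresh.
  move: uR vR => /setDP [uR uS] /setDP [vR vS].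
  have [g [g_adm g_gain g_im]] := leaf_gadget A_col rich_disj R0_rich aA a1 uR vR uv.
  apply: conclude Sa g_adm g_gain _ _ _ => //; rewrite g_im.
    by rewrite subUset !sub1set !in_setU uR vR !orbT.
  by rewrite disjoint_sym disjoints_subset subUset !sub1set !in_setC uS vS.
have ltX : #|f @: S| + 2 * Delta + Delta * D < #|X|.
  by move: Delta_D fS_le S_e1 X_ge k_ge Delta_s1 s_gt0 s01 s12 s23 s34; clear; lia.
have [g [g_adm g_gain gXR fg]] := @flip_gadget _ _ _ _ _ _ _ _ A_col T_deg rich_disj
  R0_rich rich_X c (f @: S) _ (proj2 T_tree) cA c2 nbr2 (fun U => @fresh_edge U q0) fS_fresh ltX.
apply: conclude Sc g_adm g_gain gXR fg _.
apply: leq_trans (@card_bigcup_le _ _ _ _ 3 _) _ => [a ac|]; last first.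
  by rewrite mulnC leq_mul2l T_deg.
by rewrite cardsU1; have := nbr2 a ac; rewrite degreeE => ->; case: (_ \notin _).
Qed.

(** The [q] edge gadgets come first, then one star for each hub of [Q]. [Q'] records the hubs
    already used, so the image bound shows that the next one is free. *)
Lemma star_gadgets n : n <= #|Q| -> exists S (f : T -> G) (Q' : {set G}),
  [/\ admissible A rich S f, gain A X (q + n) S f, #|S| <= 3 * Delta * (q + n),
      f @: S \subset X :|: R0 :|: Q' & Q' \subset Q /\ #|Q'| = n].
Proof.
elim: n => [_|n IHn ltn].
  have [S [f [f_adm f_gain S_le fX]]] := edge_gadgets (leqnn q).
  by exists S, f, set0; rewrite addn0 setU0 sub0set cards0.
have [S [f [Q' [f_adm f_gain S_le fX [Q'Q Q'_card]]]]] := IHn (ltnW ltn).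
have qn_m : q + n <= m by move: (ltnW ltn) Q_le; rewrite /q; clear; lia.
have S_e1 : #|S| <= 3 * s 1 by apply: leq_trans S_le (mul_le _).
have fS_le : #|f @: S| <= #|S| by apply: leq_imset_card.
have [z zQ zQ'] : exists2 z, z \in Q & z \notin Q' by apply: exists_notin; rewrite Q'_card.
have [a aA Sa] : exists2 a, a \in A & [disjoint S & a |: nbr a].
  apply: (star_place T_deg); apply: leq_trans (leq_trans (S_X S_e1) (ltnW AX)).
  by rewrite ltnS leq_addr.
have zX : z \notin X.
  by have := subsetP Q_hubs z zQ; rewrite inE in_setC => /andP [].
have zR0 : z \notin R0 by rewrite inE zQ.
have zf : z \notin f @: S.
  by apply/negP => /(subsetP fX); rewrite !in_setU (negPf zX) (negPf zR0) (negPf zQ').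
have ltR0 : #|f @: S| + Delta < #|nbr z :&: R0|.
  have : L <= #|nbr z :&: rich|.
    by have := subsetP Q_hubs z zQ; rewrite inE => /andP [].
  rewrite -(cardsID Q (nbr z :&: rich)) setIDA.
  have := subset_leq_card (subsetIr (nbr z :&: rich) Q).
  by move: fS_le S_e1 Q_le m_le Delta_s1 s_gt0 s01 s12 s23 s34; rewrite /L; clear; lia.
have [g [g_adm g_gain gR fg]] := star_gadget A_col T_deg rich_disj R0_rich aA zf zX zR0 ltR0.
have [f' [f'_adm f'_gain f'_im]] := admissible_union A_col f_adm g_adm Sa fg f_gain g_gain.
exists (S :|: (a |: nbr a)), f', (z |: Q').
have Q1 : z |: Q' \subset Q by rewrite subUset sub1set zQ.
rewrite addnS f'_im cardsU1 zQ' Q'_card Q1; split=> //.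
  exact: cardU_le.
rewrite subUset; apply/andP; split.
  by apply: subset_trans fX _; rewrite setUS // subsetUr.
apply/subsetP => w /(subsetP gR); rewrite !inE => /orP [->|->]; by rewrite ?orbT.
Qed.

Lemma embedding_gadgets : exists f : T -> G, pembedding [set: T] f.
Proof.
have [S [f [Q' [f_adm f_gain S_le _ _]]]] := star_gadgets (leqnn _).
have qQ : q + #|Q| = m by rewrite subnK.
rewrite qQ in f_gain S_le; apply: extend_admissible rich_X f_adm f_gain _.
exact: S_X (leq_trans S_le (mul_le (leqnn m))).
Qed.

End Gadgets.

Lemma embedding_large_color_class : exists f : T -> G, pembedding [set: T] f.
Proof.
have [m_hubs|hubs_m] := leqP m #|hubs|.
  (* With exactly [m] hubs in [Q] we get [q = 0]: stars suffice, and the condition on wild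
     neighbours is void. *)
  have [Q Qh Q_m] := subset_of_card m_hubs.
  by apply: (@embedding_gadgets Q); rewrite ?Q_m ?subnn.
have [/existsP [y /existsP [z /and3P [yR zW yz]]]|no] :=
    boolP [exists y, exists z, [&& y \in rich, z \in wild & edge y z]].
  exact: embedding_escape yz.
apply: (@embedding_gadgets hubs) => //; first exact: ltnW.
move=> _; split=> // y z yR zW; apply: contra no => yz.
by apply/existsP; exists y; apply/existsP; exists z; rewrite yR zW.
Qed.

End LargeColorClass.

Lemma tree_embedding : exists f : T -> G, pembedding [set: T] f.
Proof.
have [AX|AX] := leqP #|A| #|X|; first exact: embedding_small_color_class.
exact: embedding_large_color_class.
Qed.

End Core.

(** * The theorem *)

Lemma min_degree_le (G : sgraph) (v : G) : min_degree G <= degree v.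
Proof.
rewrite /min_degree; have: v \in index_enum G by rewrite mem_index_enum.
elim: (index_enum _) => // u q IHq; rewrite inE big_cons geq_min.
by case/predU1P => [->|/IHq ->]; rewrite ?leqnn ?orbT.
Qed.

Lemma small_color_class (T : sgraph) : is_tree T ->
  exists A : {set T}, two_coloring A /\ 2 * #|A| <= #|T|.
Proof.
move=> T_tree; have /card_gt0P [r _] := T_tree.1.1.
have [p [h T_root]] := rooted_tree r T_tree.
have A_col := parity_coloring T_root; set A := [set x | _] in A_col.
have [A_le|A_ge] := leqP (2 * #|A|) #|T|; first by exists A.
exists (~: A); split; first exact: two_coloringC.
by have := cardsC A; lia.
Qed.

(** * Transferring degrees from the bipartite subgraph to the host graph *)

Section SubgraphDegree.
Variables (G : sgraph) (B : subgraph G) (X Y : {set B}).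
Hypothesis B_parts : bipartition X Y.

(** The vertices of [B] form a subtype of those of [G], so its parts have to be pushed forward along
    [val]. *)
Definition lift_set (S : {set B}) : {set G} := val @: S.

Lemma card_lift_set S : #|lift_set S| = #|S|.
Proof. by rewrite card_imset //; apply: val_inj. Qed.

Lemma lift_set_disjoint : [disjoint lift_set X & lift_set Y].
Proof.
have [_ XY _] := B_parts; rewrite disjoints_subset; apply/subsetP => _ /imsetP [x xX ->].
rewrite in_setC; apply/imsetP => -[y yY /val_inj x_y].
by have := disjointFr XY xX; rewrite x_y yY.
Qed.

Lemma degree_lift_le (S : {set B}) (x : B) : (forall y, edge x y -> y \in S) ->
  degree x <= #|lift_set S :&: nbr (val x)|.
Proof.
move=> xS; rewrite degreeE -card_lift_set; apply/subset_leq_card/subsetP.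
move=> _ /imsetP [y xy ->]; have {}xy : edge x y by rewrite inE in xy.
rewrite in_setI in_nbr imset_f ?xS //=; exact: (sub_edgeG xy).
Qed.

Lemma degree_lift_X x : x \in X -> degree x <= #|lift_set Y :&: nbr (val x)|.
Proof.
have [_ XY eXY] := B_parts; move=> xX; apply: degree_lift_le => y /eXY.
by case=> -[] //; rewrite (disjointFr XY xX).
Qed.

Lemma degree_lift_Y y : y \in Y -> degree y <= #|lift_set X :&: nbr (val y)|.
Proof.
have [_ XY eXY] := B_parts; move=> yY; apply: degree_lift_le => x /eXY.
by case=> -[] //; rewrite (disjointFl XY yY).
Qed.

End SubgraphDegree.

Import Order.TTheory GRing.Theory Num.Theory.
Local Open Scope ring_scope.

Theorem theorem1p6 (R : realType) (Delta k : nat) (eps : R)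
    (Delta_gt0 : (0 < Delta)%N) (k_gt0 : (0 < k)%N)
    (eps_le : eps <= Delta%:R ^- 7 / 1000%:R) (eps_ge : k%:R^-1 <= eps)
    (T : sgraph) (T_tree : is_tree T) (T_edges : #|edge_set T| = k)
    (T_maxdeg : (max_degree T <= Delta)%N)
    (G : sgraph) (G_conn : connected G)
    (G_mindeg : k%:R / 2%:R <= (min_degree G)%:R :> R)
    (B : subgraph G) (X Y : {set B}) (B_parts : bipartition X Y)
    (X_card : #|X|%:R <= (1 + eps) * k%:R / 2%:R)
    (Y_card : (6 * k <= #|Y|)%N)
    (X_deg : forall x : B, x \in X -> (1 - eps) * #|Y|%:R <= (degree x)%:R)
    (Y_deg : forall y : B, y \in Y -> (1 - eps) * k%:R / 2%:R <= (degree y)%:R) :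
  contains_copy G T.
Proof.
have [A [A_col A_le]] := small_color_class T_tree.
have T_card : #|T| = k.+1 by rewrite card_tree // T_edges.
(* An integer [K] with [eps <= 1 / K] turns bounds by [eps * a] into divisions of naturals, as in
   [eps_nat]. *)
have [K [K1 K4 eps_K]] : exists K : nat,
    [/\ (1000 * Delta <= K)%N, (1000 * Delta ^ 4 <= K)%N & eps * K%:R <= 1].
  have Delta_pow i : (i <= 7)%N -> (Delta ^ i <= Delta ^ 7)%N by apply: leq_pexp2l.
  exists (1000 * Delta ^ 7)%N; split.
  - by rewrite leq_mul2l -{1}[Delta]expn1 Delta_pow ?orbT.
  - by rewrite leq_mul2l Delta_pow ?orbT.
  rewrite natrM natrX mulrA mulrC.
  have D7 : 0 < Delta%:R ^+ 7 :> R by rewrite exprn_gt0 ?ltr0n.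
  by rewrite -ler_pdivlMl // mulr1 -ler_pdivlMr ?ltr0n.
have eps_nat n a : n%:R <= eps * a%:R -> (K * n <= a)%N.
  move=> na; rewrite -(ler_nat R) natrM.
  have := ler_wpM2l (ler0n R K) na; move/le_trans; apply.
  by rewrite mulrA [_ * eps]mulrC -[leRHS]mul1r ler_wpM2r.
have eps_k : 1 <= eps * k%:R by rewrite -ler_pdivrMr ?ltr0n // mul1r.
(* This floor is positive because [eps >= 1 / k]. *)
pose e := Num.truncn (eps * k%:R).
have e_gt0 : (0 < e)%N by rewrite truncn_gt0.
have e_le : e%:R <= eps * k%:R by rewrite truncn_le // (le_trans ler01).
(* A vertex of [X] misses at most [eps * #|Y|] vertices of [Y], and [1000 * Delta <= K] bounds this
   by [d]. *)
pose d := (#|Y| %/ (1000 * Delta))%N.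
suff [f f_emb] : exists f : T -> G, pembedding [set: T] f.
  exact: pembedding_contains_copy f_emb.
have T_deg (x : T) : (degree x <= Delta)%N by apply: leq_trans T_maxdeg; exact: leq_bigmax.
have G_deg (v : G) : (k <= 2 * degree v)%N.
  rewrite -(ler_nat R) mulnC natrM -ler_pdivrMr ?ltr0n //.
  by apply: le_trans G_mindeg _; rewrite ler_nat min_degree_le.
have Y_X (y : G) : y \in lift_set Y -> (k <= 2 * #|lift_set X :&: nbr y| + Delta ^ 0 * e)%N.
  case/imsetP => {}y yY ->; apply: leq_trans (leq_add (leq_mul (leqnn 2) (degree_lift_Y B_parts yY)) (leqnn _)).
  (* The natural number [k - 2 * degree y] is at most [eps * k], hence at most its floor [e];
     truncated subtraction requires the case split. *)
  rewrite expn0 mul1n -leq_subLR truncn_ge_nat ?(le_trans ler01) //.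
  have [le_k|lt_k] := leqP k (2 * degree (y : B)).
    by move: le_k; rewrite -subn_eq0 => /eqP ->; rewrite (le_trans ler01).
  rewrite natrB ?(ltnW lt_k) // natrM.
  by have := Y_deg y yY; rewrite ler_pdivrMr ?ltr0n //; lra.
have X_d (x : G) : x \in lift_set X -> (#|lift_set Y :\: nbr x| <= d)%N.
  case/imsetP => {}x xX ->; rewrite leq_divRL ?muln_gt0 ?Delta_gt0 //.
  apply: leq_trans (eps_nat #|lift_set Y :\: nbr (val x : G)| #|Y| _).
    by rewrite mulnC leq_mul2r K1 orbT.
  have := cardsID (nbr (val x : G)) (lift_set Y); rewrite card_lift_set => Y_split.
  have := degree_lift_X B_parts xX; rewrite -(ler_nat R) => deg_x.
  have := X_deg x xX; move/(congr1 (fun n => n%:R : R)): Y_split; rewrite natrD.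
  by lra.
have d_le : (d * (1000 * Delta) <= #|Y|)%N by apply: leq_trunc_div.
have k1000 : (1000 * (Delta ^ 4 * e) <= k)%N.
  by apply: leq_trans (eps_nat _ _ e_le); rewrite mulnA leq_mul2r K4 orbT.
have Y_big : (#|T| + Delta * d <= #|lift_set Y|)%N.
  rewrite T_card card_lift_set; move: d_le Y_card k_gt0.
  rewrite mulnC -mulnA; move: (Delta * d)%N #|Y| => a b; clear; lia.
apply: (@tree_embedding T G A (lift_set X) (lift_set Y) Delta k (fun i => Delta ^ i * e)%N
  T_tree T_edges A_col _ T_deg G_deg (lift_set_disjoint B_parts) _ Y_X Delta_gt0 _ _ k1000 d
  X_d Y_big).
- by rewrite -T_card.
- by rewrite card_lift_set.
- by rewrite expn0 mul1n.
- by move=> i; rewrite expnS mulnA.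
Qed.
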